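(* (i) Let $R$ be a Hopf $F$-algebra and let $T = R[x;\sigma,\delta]$ be a Hopf Ore extension of $R$, so that $\Delta(x)=a\otimes x+x\otimes b+v(x\otimes x)+w$ with $a,b\in R$ and $v,w\in R\otimes R$. Suppose that (H) $S(x)=\alpha x+\beta$ for some $\alpha,\beta\in R$ with $\alpha$ a unit of $R$. Write $w=\sum w_1\otimes w_2\in R\otimes R$, with $\{w_1\}$ and $\{w_2\}$ chosen to be $F$-linearly independent subsets of $R$. Then: (a) $a,b\in G(R)$ and $v=0$. (b) After a change of the variable $x$ and corresponding adjustments to $\sigma$, $\delta$ and $w$, one has $\varepsilon(x)=0$ and $\Delta(x)=a\otimes x+x\otimes 1+w$. Assume from now on in (i) that $\varepsilon(x)=0$ and $\Delta(x)=a\otimes x+x\otimes 1+w$. Then: (c) $S(x)=-a^{-1}\big(x+\sum w_1S(w_2)\big)$. (d) There is a character $\chi:R\to F$ such that, for all $r\in R$, $\sigma(r)=\chi(r_1)r_2=ar_1a^{-1}\chi(r_2)$; that is, $\sigma$ is the left winding automorphism $\tau^{\ell}_{\chi}$ (where $\tau^{\ell}_{\chi}(r)=\chi(r_1)r_2$), and equals the composition $\mathrm{ad}(a)\circ\tau^{r}_{\chi}$ of the right winding automorphism $\tau^r_\chi(r)=r_1\chi(r_2)$ with conjugation $\mathrm{ad}(a)(r)=ara^{-1}$. (e) The $\sigma$-derivation $\delta$ satisfies, for all $r\in R$, $\Delta\delta(r)-\delta(r_1)\otimes r_2-ar_1\otimes\delta(r_2)=w\Delta(r)-\Delta\sigma(r)w$.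 (f) $w\in R^+\otimes R^+$, and $w$ satisfies $\sum S(w_1)w_2=a^{-1}\sum w_1S(w_2)$ and $w\otimes 1+(\Delta\otimes\mathrm{Id})(w)=a\otimes w+(\mathrm{Id}\otimes\Delta)(w)$. (ii) Conversely, let $R$ be a Hopf $F$-algebra, and suppose given $a\in G(R)$, $w=\sum w_1\otimes w_2\in R\otimes R$, an $F$-algebra automorphism $\sigma$ of $R$ and a $\sigma$-derivation $\delta$ of $R$ such that this data satisfies (d), (e) and (f) of (i). Then the skew polynomial algebra $T=R[x;\sigma,\delta]$ admits a structure of Hopf algebra with $R$ as a Hopf subalgebra, in which $\Delta(x)=a\otimes x+x\otimes 1+w$, $\varepsilon(x)=0$ and $S(x)=-a^{-1}\big(x+\sum w_1S(w_2)\big)$ (so that (H), (a), (b) and (c) of (i) hold). As a consequence, $T$ is a Hopf Ore extension of $R$.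
   Context: $F$ is an arbitrary field; Hopf algebras are assumed to have bijective antipode; Sweedler notation $\Delta(h)=h_1\otimes h_2$ is used; $G(R)$ denotes the group-like elements of $R$ and $R^+$ the augmentation ideal. For an $F$-algebra automorphism $\sigma$ of $R$, a (left) $\sigma$-derivation $\delta$ is an $F$-linear map with $\delta(ab)=\delta(a)b+\sigma(a)\delta(b)$; the skew polynomial algebra $T=R[x;\sigma,\delta]$ is generated by $R$ and $x$ subject to $xr-\sigma(r)x=\delta(r)$ for all $r\in R$. A Hopf Ore extension (HOE) of a Hopf $F$-algebra $R$ is a Hopf $F$-algebra $T$ having $R$ as a Hopf subalgebra, such that $T=R[x;\sigma,\delta]$ for some automorphism $\sigma$ and $\sigma$-derivation $\delta$ of $R$, and such that $\Delta(x)=a\otimes x+x\otimes b+v(x\otimes x)+w$ for some $a,b\in R$ and $v,w\in R\otimes R$. *)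

(* Defs.v *)
(* Tensor products R ⊗ R (and R ⊗ R ⊗ R) are represented by
   finite lists of pure tensors (formal sums), identified up to the
   equivalence defining the tensor product: two formal sums are equal in
   U ⊗ V iff every bilinear map out of U × V takes the same value on them. *)
From HB Require Import structures.
From mathcomp Require Import all_boot all_order all_algebra.
Set Implicit Arguments.
Unset Strict Implicit.
Unset Printing Implicit Defensive.
Import GRing.Theory.
Local Open Scope ring_scope.

Section Tensor.
Variable F : fieldType.

Definition bilinear_map (U V Z : lmodType F) (f : U -> V -> Z) : Prop :=
  (forall (c : F) u u' v, f (c *: u + u') v = c *: f u v + f u' v) /\
  (forall (c : F) u v v', f u (c *: v + v') = c *: f u v + f u v').

Definition trilinear_map (U V W Z : lmodType F) (f : U -> V -> W -> Z) : Prop :=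
  [/\ (forall (c : F) u u' v w, f (c *: u + u') v w = c *: f u v w + f u' v w),
      (forall (c : F) u v v' w, f u (c *: v + v') w = c *: f u v w + f u v' w) &
      (forall (c : F) u v w w', f u v (c *: w + w') = c *: f u v w + f u v w')].

Definition teq2 (U V : lmodType F) (s t : seq (U * V)) : Prop :=
  forall (Z : lmodType F) (f : U -> V -> Z), bilinear_map f ->
    \sum_(p <- s) f p.1 p.2 = \sum_(p <- t) f p.1 p.2.

Definition teq3 (U V W : lmodType F) (s t : seq (U * V * W)) : Prop :=
  forall (Z : lmodType F) (f : U -> V -> W -> Z), trilinear_map f ->
    \sum_(p <- s) f p.1.1 p.1.2 p.2 = \sum_(p <- t) f p.1.1 p.1.2 p.2.

Definition linearF (U V : lmodType F) (f : U -> V) : Prop :=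
  forall (c : F) u u', f (c *: u + u') = c *: f u + f u'.
End Tensor.

Section HopfDefs.
Variables (F : fieldType) (R : algType F).

Definition tmul (s t : seq (R * R)) : seq (R * R) :=
  [seq (p.1 * q.1, p.2 * q.2) | p <- s, q <- t].
Definition tscale (c : F) (s : seq (R * R)) : seq (R * R) :=
  [seq (c *: p.1, p.2) | p <- s].
Definition tneg (s : seq (R * R)) : seq (R * R) := [seq (- p.1, p.2) | p <- s].

Definition is_hopf (D : R -> seq (R * R)) (e : R -> F) (S : R -> R) : Prop :=
  (forall (c : F) r s, teq2 (D (c *: r + s)) (tscale c (D r) ++ D s)) /\
  (forall r s, teq2 (D (r * s)) (tmul (D r) (D s))) /\
  teq2 (D 1) [:: (1, 1)] /\
  (forall r, teq3 [seq (q.1, q.2, p.2) | p <- D r, q <- D p.1]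
                  [seq (p.1, q.1, q.2) | p <- D r, q <- D p.2]) /\
  (forall (c : F) r s, e (c *: r + s) = c * e r + e s) /\
  (forall r s, e (r * s) = e r * e s) /\ e 1 = 1 /\
  (forall r, \sum_(p <- D r) e p.1 *: p.2 = r) /\
  (forall r, \sum_(p <- D r) e p.2 *: p.1 = r) /\
  linearF S /\
  (forall r, \sum_(p <- D r) S p.1 * p.2 = e r *: 1) /\
  (forall r, \sum_(p <- D r) p.1 * S p.2 = e r *: 1) /\
  bijective S.

Definition grouplike (D : R -> seq (R * R)) (g : R) : Prop :=
  teq2 (D g) [:: (g, g)] /\ g != 0.

Definition alg_auto (sigma : R -> R) : Prop :=
  linearF sigma /\ (forall r s, sigma (r * s) = sigma r * sigma s) /\
  sigma 1 = 1 /\ bijective sigma.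

Definition sigma_der (sigma delta : R -> R) : Prop :=
  linearF delta /\ (forall r s, delta (r * s) = delta r * s + sigma r * delta s).

Definition character (chi : R -> F) : Prop :=
  (forall (c : F) r s, chi (c *: r + s) = c * chi r + chi s) /\
  (forall r s, chi (r * s) = chi r * chi s) /\ chi 1 = 1.

Definition conds_def (D : R -> seq (R * R)) (e : R -> F) (S : R -> R)
    (a ainv : R) (w : seq (R * R)) (sigma delta : R -> R) : Prop :=
  (exists chi : R -> F, character chi /\
     forall r, sigma r = \sum_(p <- D r) chi p.1 *: p.2 /\
               sigma r = \sum_(p <- D r) chi p.2 *: (a * p.1 * ainv)) /\
  (forall r, teq2 (D (delta r) ++ tneg [seq (delta p.1, p.2) | p <- D r]
                               ++ tneg [seq (a * p.1, delta p.2) | p <- D r])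
                  (tmul w (D r) ++ tneg (tmul (D (sigma r)) w))) /\
  (exists w' : seq (R * R), teq2 w w' /\
      all (fun p => (e p.1 == 0) && (e p.2 == 0)) w') /\
  \sum_(p <- w) S p.1 * p.2 = ainv * \sum_(p <- w) p.1 * S p.2 /\
  teq3 ([seq (p.1, p.2, 1) | p <- w] ++ [seq (q.1, q.2, p.2) | p <- w, q <- D p.1])
       ([seq (a, p.1, p.2) | p <- w] ++ [seq (p.1, q.1, q.2) | p <- w, q <- D p.2]).
End HopfDefs.

Section HOEDefs.
Variables (F : fieldType) (R T : algType F).
Variables (DR : R -> seq (R * R)) (eR : R -> F) (SR : R -> R).
Variables (DT : T -> seq (T * T)) (eT : T -> F) (ST : T -> T).

Definition tmap (i : R -> T) (s : seq (R * R)) : seq (T * T) :=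
  [seq (i p.1, i p.2) | p <- s].

Definition hopf_subalg (i : R -> T) : Prop :=
  injective i /\ linearF i /\ (forall r s, i (r * s) = i r * i s) /\ i 1 = 1 /\
  (forall r, teq2 (DT (i r)) (tmap i (DR r)) /\ eT (i r) = eR r /\
             ST (i r) = i (SR r)).

(* T = R[x; sigma, delta]: T is a free left R-module on the powers of x,
   with x r = sigma(r) x + delta(r) *)
Definition skew_poly (i : R -> T) (x : T) (sigma delta : R -> R) : Prop :=
  (forall r, x * i r = i (sigma r) * x + i (delta r)) /\
  (forall t : T, exists s : seq R, t = \sum_(k < size s) i s`_k * x ^+ k) /\
  (forall s : seq R, \sum_(k < size s) i s`_k * x ^+ k = 0 -> all (fun r => r == 0) s).

Definition HOE (i : R -> T) (x : T) (sigma delta : R -> R) (a b : R)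
    (v w : seq (R * R)) : Prop :=
  is_hopf DR eR SR /\ is_hopf DT eT ST /\ hopf_subalg i /\
  alg_auto sigma /\ sigma_der sigma delta /\ skew_poly i x sigma delta /\
  teq2 (DT x) ([:: (i a, x); (x, i b)]
               ++ [seq (i p.1 * x, i p.2 * x) | p <- v] ++ tmap i w).
End HOEDefs.

(* Main.v *)
(* Write [c_k : T -> R] for the coefficient of [x^k].  In part (i) every identity
   in [T (x) T] or [T (x) T (x) T] is tested against multilinear maps of the form
   [f (c_j _) (c_k _)].  The coefficient of [x^2] in the antipode axiom for [x]
   gives [sum S(v_1) v_2 = 0].  Coassociativity at [x], after applying the counit
   to the coefficient of [x] in one tensor factor, gives
   [Delta a + Delta(v'') w = a (x) a], [Delta b + Delta(v') w = b (x) b] and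
   [v (a (x) 1) = a (x) v'], where [v' = sum eps(v_1) v_2] and
   [v'' = sum v_1 eps(v_2)].  Applying [S (x) id] and multiplying, [S a] and [S b]
   are left inverses of [a] and [b]; together with [S a = - alpha sigma(b)] this
   makes [a] and [b] units, so [v = 1 (x) v'], whence [v' = sum S(v_1) v_2 = 0].
   Conditions (c)-(f) are comparisons of coefficients in the axioms at [x] and in
   [Delta(x) Delta(r) = Delta(sigma r) Delta(x) + Delta(delta r)].

   In part (ii) the comultiplication, counit and antipode come from the universal
   property of [R[x; sigma, delta]], with values in [T (x) T], [F] and the
   opposite algebra of [T].  The relations needed for the antipode,
   [S(r) a^-1 = a^-1 sigma(S(sigma r))] and
   [S(delta r) = a^-1 delta(S(sigma r)) + U S(sigma r) - S(r) U] with
   [U = sum S(w_1) w_2], hold because both sides have the same convolution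
   product with the identity. *)
Require Import Defs.
From HB Require Import structures.
From mathcomp Require Import all_boot all_order all_algebra.
From mathcomp Require Import ssrAC generic_quotient boolp.
Set Implicit Arguments.
Unset Strict Implicit.
Unset Printing Implicit Defensive.
Import GRing.Theory.
Local Open Scope ring_scope.

(** * Linear and multilinear maps *)

(** Phrased with the product of [F] instead of the scaling of [F^o], as counits and characters are;
    the lemmas on linear forms are the [linearF] ones at codomain [F^o]. *)
Definition linformF (F : fieldType) (U : lmodType F) (f : U -> F) : Prop :=
  forall (c : F) u u', f (c *: u + u') = c * f u + f u'.

(** Formal sums form no module, so linearity of a comultiplication is asked for up to [teq2]. *)
Definition linearT (F : fieldType) (U : lmodType F) (R : algType F)
    (D : U -> seq (R * R)) : Prop :=
  forall (c : F) r s, teq2 (D (c *: r + s)) (tscale c (D r) ++ D s).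

Section Linear.
Variable F : fieldType.
Implicit Types U V W X Z : lmodType F.

Lemma bilinearP U V Z (f : U -> V -> Z) :
  (forall v, linearF (fun u => f u v)) -> (forall u, linearF (fun v => f u v)) ->
  bilinear_map f.
Proof. by move=> h1 h2; split=> *; [apply: h1 | apply: h2]. Qed.

Lemma trilinearP U V W Z (f : U -> V -> W -> Z) :
  (forall v w, linearF (fun u => f u v w)) ->
  (forall u w, linearF (fun v => f u v w)) ->
  (forall u v, linearF (fun w => f u v w)) -> trilinear_map f.
Proof. by move=> h1 h2 h3; split=> *; [apply: h1 | apply: h2 | apply: h3]. Qed.

Lemma linearF_id U : linearF (fun u : U => u).
Proof. by []. Qed.

Lemma linearF_comp U V Z (g : V -> Z) (h : U -> V) :
  linearF g -> linearF h -> linearF (fun u => g (h u)).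
Proof. by move=> hg hh c u u'; rewrite hh hg. Qed.

Lemma linearF_bil1 U V W Z (f : U -> V -> Z) (h : W -> U) v :
  bilinear_map f -> linearF h -> linearF (fun u => f (h u) v).
Proof. by move=> [hf _] hh c u u'; rewrite hh hf. Qed.

Lemma linearF_bil2 U V W Z (f : U -> V -> Z) (h : W -> V) u :
  bilinear_map f -> linearF h -> linearF (fun v => f u (h v)).
Proof. by move=> [_ hf] hh c v v'; rewrite hh hf. Qed.

Lemma linearF_tri1 U V W X Z (f : U -> V -> W -> Z) (h : X -> U) v w :
  trilinear_map f -> linearF h -> linearF (fun u => f (h u) v w).
Proof. by move=> [hf _ _] hh c u u'; rewrite hh hf. Qed.

Lemma linearF_tri2 U V W X Z (f : U -> V -> W -> Z) (h : X -> V) u w :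
  trilinear_map f -> linearF h -> linearF (fun v => f u (h v) w).
Proof. by move=> [_ hf _] hh c v v'; rewrite hh hf. Qed.

Lemma linearF_tri3 U V W X Z (f : U -> V -> W -> Z) (h : X -> W) u v :
  trilinear_map f -> linearF h -> linearF (fun w => f u v (h w)).
Proof. by move=> [_ _ hf] hh c w w'; rewrite hh hf. Qed.

Lemma linearF_mull U (A : algType F) (g : U -> A) y :
  linearF g -> linearF (fun u => g u * y).
Proof. by move=> hg c u u'; rewrite hg mulrDl -scalerAl. Qed.

Lemma linearF_mulr U (A : algType F) (g : U -> A) y :
  linearF g -> linearF (fun u => y * g u).
Proof. by move=> hg c u u'; rewrite hg mulrDr -scalerAr. Qed.

Lemma linearF_add U V (g h : U -> V) :
  linearF g -> linearF h -> linearF (fun u => g u + h u).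
Proof. by move=> hg hh c u u'; rewrite hg hh scalerDr addrACA. Qed.

Lemma linearF_opp U V (g : U -> V) : linearF g -> linearF (fun u => - g u).
Proof. by move=> hg c u u'; rewrite hg opprD scalerN. Qed.

Lemma linearF_sum U V (I : Type) (s : seq I) (g : I -> U -> V) :
  (forall p, linearF (g p)) -> linearF (fun u => \sum_(p <- s) g p u).
Proof.
move=> hg c u u'; rewrite scaler_sumr -big_split /=.
by apply: eq_bigr => p _; rewrite hg.
Qed.

Lemma linearF_scale U V (g : U -> V) (c : F) :
  linearF g -> linearF (fun u => c *: g u).
Proof. by move=> hg d u u'; rewrite hg scalerDr !scalerA mulrC. Qed.

Lemma linearF_form U W V (g : W -> F) (h : U -> W) (v : V) :
  linformF g -> linearF h -> linearF (fun u => g (h u) *: v).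
Proof. by move=> hg hh d u u'; rewrite hh hg scalerDl scalerA. Qed.

Lemma linformF_comp U V (g : V -> F) (h : U -> V) :
  linformF g -> linearF h -> linformF (fun u => g (h u)).
Proof. by move=> hg hh d u u'; rewrite hh hg. Qed.

Lemma linearFD U V (g : U -> V) : linearF g -> {morph g : u v / u + v}.
Proof. by move=> hg u v; have := hg 1 u v; rewrite !scale1r. Qed.

Lemma linearF0 U V (g : U -> V) : linearF g -> g 0 = 0.
Proof. by move=> hg; apply: (addrI (g 0)); rewrite -(linearFD hg) [in LHS]addr0 addr0. Qed.

Lemma linearFZ U V (g : U -> V) c u : linearF g -> g (c *: u) = c *: g u.
Proof. by move=> hg; have := hg c u 0; rewrite (linearF0 hg) !addr0. Qed.

Lemma linearFN U V (g : U -> V) u : linearF g -> g (- u) = - g u.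
Proof. by move=> hg; rewrite -scaleN1r (linearFZ _ _ hg) scaleN1r. Qed.

Lemma linearFsum U V (I : Type) (s : seq I) (h : I -> U) (g : U -> V) :
  linearF g -> g (\sum_(p <- s) h p) = \sum_(p <- s) g (h p).
Proof. by move=> hg; apply: (big_morph g (linearFD hg) (linearF0 hg)). Qed.

Lemma linformFsum U (I : Type) (s : seq I) (h : I -> U) (g : U -> F) :
  linformF g -> g (\sum_(p <- s) h p) = \sum_(p <- s) g (h p).
Proof. by move=> hg; apply: (@linearFsum U F^o). Qed.

Lemma linformFZ U (g : U -> F) c u : linformF g -> g (c *: u) = c * g u.
Proof. by move=> hg; apply: (@linearFZ U F^o). Qed.

Lemma linformFD U (g : U -> F) : linformF g -> {morph g : u v / u + v}.
Proof. by move=> hg; apply: (@linearFD U F^o). Qed.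

Lemma linformFN U (g : U -> F) u : linformF g -> g (- u) = - g u.
Proof. by move=> hg; apply: (@linearFN U F^o). Qed.

Lemma linformF0 U (g : U -> F) : linformF g -> g 0 = 0.
Proof. by move=> hg; apply: (@linearF0 U F^o). Qed.

End Linear.

(** * Formal sums of pure tensors *)

Section Formal.
Variable F : fieldType.
Implicit Types R T : algType F.

Lemma sum_tscale R (Z : lmodType F) (f : R -> R -> Z) c s : bilinear_map f ->
  \sum_(p <- tscale c s) f p.1 p.2 = c *: \sum_(p <- s) f p.1 p.2.
Proof.
move=> hf; rewrite big_map scaler_sumr; apply: eq_bigr => p _ /=.
by apply: (linearFZ (g := fun u => f u p.2)) => d u u'; rewrite hf.1.
Qed.

Lemma sum_tneg R (Z : lmodType F) (f : R -> R -> Z) s : bilinear_map f ->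
  \sum_(p <- tneg s) f p.1 p.2 = - \sum_(p <- s) f p.1 p.2.
Proof.
move=> hf; rewrite -scaleN1r -sum_tscale //; congr bigop.
by apply: eq_map => p; rewrite scaleN1r.
Qed.

Lemma sum_tmul R (Z : zmodType) (f : R -> R -> Z) s t :
  \sum_(p <- tmul s t) f p.1 p.2 =
  \sum_(p <- s) \sum_(q <- t) f (p.1 * q.1) (p.2 * q.2).
Proof. by rewrite /tmul big_allpairs_dep. Qed.

Lemma sum_tmap R T (i : R -> T) (Z : zmodType) (f : T -> T -> Z) s :
  \sum_(p <- tmap i s) f p.1 p.2 = \sum_(p <- s) f (i p.1) (i p.2).
Proof. by rewrite /tmap big_map. Qed.

(** The summand is a function of the pair, so that it unifies with an arbitrary body under the sum.
    Linearity of [D] up to [teq2] is enough because the summand is bilinear. *)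
Lemma linearF_sumD (U W : lmodType F) R (D : U -> seq (R * R)) (Z : lmodType F)
    (f : R * R -> Z) (h : W -> U) :
  linearT D -> bilinear_map (fun u v => f (u, v)) -> linearF h ->
  linearF (fun u => \sum_(p <- D (h u)) f p).
Proof.
move=> hD hf hh c u u'; have fE p : f p = f (p.1, p.2) by case: p.
under eq_bigr => p _ do rewrite fE.
under [X in _ = _ *: X + _]eq_bigr => p _ do rewrite fE.
under [X in _ = _ + X]eq_bigr => p _ do rewrite fE.
by rewrite hh (hD _ _ _ _ _ hf) big_cat /= (sum_tscale _ _ hf).
Qed.

End Formal.

(* Unification may leave the functions eta-reduced. *)
Ltac eta_linear :=
  lazymatch goal with
  | |- linearF ?g => change (linearF (fun u => g u))
  | |- linformF ?g => change (linformF (fun u => g u))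
  | |- _ => idtac
  end; cbv beta.

(** Multilinearity by recursion on the body, with hypotheses on the named maps taken from the
    context. Since [match] backtracks, a rule tried with the variable in the wrong argument is
    abandoned for the next one. *)
Ltac lin := intros; eta_linear; first
  [ assumption
  | match goal with
    | |- bilinear_map _ => apply: bilinearP; lin
    | |- trilinear_map _ => apply: trilinearP; lin
    | |- linearF (fun u => u) => apply: linearF_id
    | |- linearF (fun u => _ + _) => apply: linearF_add; lin
    | |- linearF (fun u => - _) => apply: linearF_opp; lin
    | |- linearF (fun u => ?g _ *: ?v) => apply: (linearF_form (g := g)); lin
    | |- linearF (fun u => ?c *: _) => apply: linearF_scale; lin
    | |- linearF (fun u => _ * ?v) => apply: linearF_mull; lin
    | |- linearF (fun u => ?v * _) => apply: linearF_mulr; lin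
    | |- linearF (fun u => \sum_(p <- ?s) _) => apply: linearF_sum; lin
    | |- linearF (fun u => \sum_(p <- ?D _) _) => apply: (linearF_sumD (D := D)); cbn [fst snd]; lin
    | H : bilinear_map ?f |- linearF (fun u => ?f _ ?v) =>
        apply: (linearF_bil1 (f := f)); lin
    | H : bilinear_map ?f |- linearF (fun u => ?f ?v _) =>
        apply: (linearF_bil2 (f := f)); lin
    | H : trilinear_map ?f |- linearF (fun u => ?f _ ?v ?w) =>
        apply: (linearF_tri1 (f := f)); lin
    | H : trilinear_map ?f |- linearF (fun u => ?f ?v _ ?w) =>
        apply: (linearF_tri2 (f := f)); lin
    | H : trilinear_map ?f |- linearF (fun u => ?f ?v ?w _) =>
        apply: (linearF_tri3 (f := f)); lin
    | H : linearF ?g |- linearF (fun u => ?g _) => apply: (linearF_comp H); lin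
    | H : linformF ?g |- linformF (fun u => ?g _) => apply: (linformF_comp H); lin
    end ].

(** * Compatibility of tensor equality with sums, opposites and products *)

Section Congruence.
Variables (F : fieldType) (R : algType F).
Implicit Types s t : seq (R * R).

Lemma teq2_sym s t : teq2 s t -> teq2 t s.
Proof. by move=> h Z f hf; rewrite h. Qed.

Lemma teq2_trans t s u : teq2 s t -> teq2 t u -> teq2 s u.
Proof. by move=> h h' Z f hf; rewrite h // h'. Qed.

Lemma teq2_cat s s' t t' : teq2 s s' -> teq2 t t' -> teq2 (s ++ t) (s' ++ t').
Proof. by move=> h h' Z f hf; rewrite !big_cat /= h // h'. Qed.

Lemma teq2_neg s s' : teq2 s s' -> teq2 (tneg s) (tneg s').
Proof. by move=> h Z f hf; rewrite !sum_tneg // h. Qed.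

Lemma teq2_mul s s' t t' : teq2 s s' -> teq2 t t' -> teq2 (tmul s t) (tmul s' t').
Proof.
move=> h h' Z f hf; rewrite !sum_tmul.
rewrite (h _ (fun u v => \sum_(q <- t) f (u * q.1) (v * q.2))); last by lin.
by apply: eq_bigr => p _; apply: (h' _ (fun u v => f (p.1 * u) (p.2 * v))); lin.
Qed.

End Congruence.

(** * Hopf algebras *)

Section Hopf.
Variables (F : fieldType) (R : algType F).
Variables (D : R -> seq (R * R)) (e : R -> F) (S : R -> R).
Hypothesis hopfR : is_hopf D e S.

Lemma hopf_linD : linearT D. Proof. by case: hopfR. Qed.

Lemma hopf_lin_counit : linformF e.
Proof. by case: hopfR => _ [_ [_ [_ []]]]. Qed.

Lemma hopf_lin_antipode : linearF S.
Proof. by case: hopfR => _ [_ [_ [_ [_ [_ [_ [_ [_ []]]]]]]]]. Qed.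

Lemma counitM r s : e (r * s) = e r * e s.
Proof. by case: hopfR => _ [_ [_ [_ [_ []]]]]. Qed.

Lemma counit1 : e 1 = 1.
Proof. by case: hopfR => _ [_ [_ [_ [_ [_ []]]]]]. Qed.

Lemma counitl r : \sum_(p <- D r) e p.1 *: p.2 = r.
Proof. by case: hopfR => _ [_ [_ [_ [_ [_ [_ []]]]]]]. Qed.

Lemma counitr r : \sum_(p <- D r) e p.2 *: p.1 = r.
Proof. by case: hopfR => _ [_ [_ [_ [_ [_ [_ [_ []]]]]]]]. Qed.

Lemma antipodel r : \sum_(p <- D r) S p.1 * p.2 = e r *: 1.
Proof. by case: hopfR => _ [_ [_ [_ [_ [_ [_ [_ [_ [_ []]]]]]]]]]. Qed.

Lemma antipoder r : \sum_(p <- D r) p.1 * S p.2 = e r *: 1.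
Proof. by case: hopfR => _ [_ [_ [_ [_ [_ [_ [_ [_ [_ [_ []]]]]]]]]]]. Qed.

Lemma antipode_bij : bijective S.
Proof. by case: hopfR => _ [_ [_ [_ [_ [_ [_ [_ [_ [_ [_ []]]]]]]]]]]. Qed.

Let linD := hopf_linD.
Let line := hopf_lin_counit.
Let linS := hopf_lin_antipode.

Lemma teq2_DM r s : teq2 (D (r * s)) (tmul (D r) (D s)).
Proof. by case: hopfR => _ []. Qed.

Lemma teq2_D1 : teq2 (D 1) [:: (1, 1)].
Proof. by case: hopfR => _ [_ []]. Qed.

Lemma sum_DM (Z : lmodType F) (f : R -> R -> Z) r s : bilinear_map f ->
  \sum_(p <- D (r * s)) f p.1 p.2 =
  \sum_(p <- D r) \sum_(q <- D s) f (p.1 * q.1) (p.2 * q.2).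
Proof. by move=> hf; rewrite (teq2_DM r s hf) sum_tmul. Qed.

Lemma coassoc (Z : lmodType F) (f : R -> R -> R -> Z) r : trilinear_map f ->
  \sum_(p <- D r) \sum_(q <- D p.1) f q.1 q.2 p.2 =
  \sum_(p <- D r) \sum_(q <- D p.2) f p.1 q.1 q.2.
Proof.
move=> hf; case: hopfR => _ [_ [_ [co _]]].
by have := co r Z f hf; rewrite !big_allpairs_dep.
Qed.

Lemma counitl_lin (Z : lmodType F) (g : R -> Z) r : linearF g ->
  \sum_(p <- D r) e p.1 *: g p.2 = g r.
Proof.
move=> hg; rewrite -[in RHS](counitl r) (linearFsum _ _ hg).
by apply: eq_bigr => p _; rewrite (linearFZ _ _ hg).
Qed.

Lemma counitr_lin (Z : lmodType F) (g : R -> Z) r : linearF g ->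
  \sum_(p <- D r) e p.2 *: g p.1 = g r.
Proof.
move=> hg; rewrite -[in RHS](counitr r) (linearFsum _ _ hg).
by apply: eq_bigr => p _; rewrite (linearFZ _ _ hg).
Qed.

(* The identity is convolution invertible, with inverse the antipode. *)
Lemma conv_id_inj (g h : R -> R) : linearF g -> linearF h ->
  (forall r, \sum_(p <- D r) g p.1 * p.2 = \sum_(p <- D r) h p.1 * p.2) -> g =1 h.
Proof.
(* Convolving with [S] undoes convolving with the identity: [main] recovers [k] from its convolution
   with the identity. *)
suff main k : linearF k -> forall r,
    k r = \sum_(p <- D r) (\sum_(q <- D p.1) k q.1 * q.2) * S p.2.
  move=> hg hh eq_gh r; rewrite (main g) // (main h) //.
  by apply: eq_bigr => p _; rewrite eq_gh.
move=> hk r; rewrite -[LHS](counitr_lin r hk).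
under eq_bigr => p _ do
  rewrite -[k p.1]mulr1 scalerAr -antipoder mulr_sumr.
rewrite -(@coassoc _ (fun u v w => k u * (v * S w))); last by lin.
by apply: eq_bigr => p _; rewrite mulr_suml; apply: eq_bigr => q _; rewrite mulrA.
Qed.

Lemma antipode1 : S 1 = 1.
Proof.
have := antipodel 1; rewrite (@teq2_D1 _ (fun u v => S u * v)); last by lin.
by rewrite big_seq1 /= mulr1 counit1 scale1r.
Qed.

(** The identity is cancelled under convolution twice: in the second factor to obtain [mixed], then
    in the first factor, where [mixed] evaluates the left side. *)
Lemma antipodeM r s : S (r * s) = S s * S r.
Proof.
have mixed t u : \sum_(p <- D t) S (p.1 * u) * p.2 = e t *: S u.
  move: u; apply: conv_id_inj => [||u]; try by lin.
  transitivity (\sum_(p <- D (t * u)) S p.1 * p.2).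
    rewrite (@sum_DM _ (fun u v => S u * v)); last by lin.
    rewrite exchange_big; apply: eq_bigr => q _; rewrite mulr_suml.
    by apply: eq_bigr => p _; rewrite mulrA.
  under [RHS]eq_bigr => p _ do rewrite -scalerAl.
  by rewrite -scaler_sumr !antipodel counitM scalerA.
move: r; apply: conv_id_inj => [||r]; try by lin.
rewrite mixed; under eq_bigr => p _ do rewrite -mulrA.
by rewrite -mulr_sumr antipodel -scalerAr mulr1.
Qed.

(** Apply [e] to [antipodel]: multiplicativity of [e] and the right counit axiom turn the sum into
    [e (S r)]. *)
Lemma counit_antipode r : e (S r) = e r.
Proof.
have := congr1 e (antipodel r).
rewrite (linformFsum _ _ line) (linformFZ _ _ line) counit1 mulr1 => <-.
have linES : @linearF F R F^o (fun u => e (S u)) by move=> c u v; rewrite linS line.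
rewrite -[LHS](@counitr_lin F^o (fun u => e (S u))) //.
by apply: eq_bigr => p _; rewrite counitM mulrC.
Qed.

(** The counit axiom reads [e g *: g = g], and [g] is nonzero. *)
Lemma grouplike_counit g : grouplike D g -> e g = 1.
Proof.
case=> Dg g0; have := counitl g.
rewrite (Dg _ (fun u v => e u *: v)); last by lin.
rewrite big_seq1 /= => /eqP; rewrite -subr_eq0 -[X in _ - X]scale1r -scalerBl.
by rewrite scaler_eq0 (negPf g0) orbF subr_eq0 => /eqP.
Qed.

Lemma grouplike_antipode g : grouplike D g -> S g * g = 1 /\ g * S g = 1.
Proof.
move=> gg; have [Dg _] := gg.
split.
  have := antipodel g; rewrite (Dg _ (fun u v => S u * v)); last by lin.
  by rewrite big_seq1 /= (grouplike_counit gg) scale1r.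
have := antipoder g; rewrite (Dg _ (fun u v => u * S v)); last by lin.
by rewrite big_seq1 /= (grouplike_counit gg) scale1r.
Qed.

(** Multiply [D (g * g') = 1 (x) 1] on the left by [g' (x) g']; the factor [D g = g (x) g] cancels
    and leaves [D g']. *)
Lemma grouplikeV g g' : teq2 (D g) [:: (g, g)] -> g * g' = 1 -> g' * g = 1 ->
  teq2 (D g') [:: (g', g')].
Proof.
move=> Dg gg' g'g Z f hf; rewrite big_seq1 /=.
have hf' : bilinear_map (fun u v => f (g' * u) (g' * v)) by lin.
have hf2 q : bilinear_map (fun u v => f (g' * (u * q.1)) (g' * (v * q.2))) by lin.
have := @teq2_D1 _ _ hf'; rewrite big_seq1 /= !mulr1 => <-.
rewrite -gg' (sum_DM _ _ hf') exchange_big; apply: eq_bigr => q _ /=.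
by rewrite (Dg _ _ (hf2 q)) big_seq1 /= !mulrA g'g !mul1r; case: q.
Qed.

End Hopf.

(** * Coefficients in a skew polynomial algebra *)

Section Skew.
Variables (F : fieldType) (R T : algType F) (i : R -> T) (x : T).
Variables (sigma delta : R -> R).
Hypothesis lini : linearF i.
Hypothesis iM : forall r s, i (r * s) = i r * i s.
Hypothesis i1 : i 1 = 1.
Hypothesis lin_sigma : linearF sigma.
Hypothesis sigmaM : forall r s, sigma (r * s) = sigma r * sigma s.
Hypothesis sigma1 : sigma 1 = 1.
Hypothesis der : sigma_der sigma delta.
Hypothesis skewT : skew_poly i x sigma delta.

Lemma skew_coefs_subproof (t : T) :
  exists s : seq R, t == \sum_(k < size s) i s`_k * x ^+ k.
Proof. by case: skewT => _ [/(_ t)[s ->] _]; exists s. Qed.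

(** Read off from a chosen expansion; [skew_coef_unique] shows that the choice does not matter. *)
Definition skew_coef (k : nat) (t : T) : R := (xchoose (skew_coefs_subproof t))`_k.

Lemma skew_free n (g : nat -> R) :
  \sum_(k < n) i (g k) * x ^+ k = 0 -> forall k, (k < n)%N -> g k = 0.
Proof.
move=> g0 k kn; case: skewT => _ [_ /(_ (mkseq g n))].
rewrite size_mkseq => /(_ _)/allP free.
have -> : g k = (mkseq g n)`_k by rewrite nth_mkseq.
apply/eqP/free; last by rewrite mem_nth // size_mkseq.
by rewrite -[RHS]g0; apply: eq_bigr => j _; rewrite nth_mkseq.
Qed.

(** Stated for all large [N], so that several elements can be expanded at a common length; the
    vanishing at [N] removes the top term when a sum is shifted. *)
Lemma skew_coefE t : exists n, forall N, (n <= N)%N ->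
  skew_coef N t = 0 /\ t = \sum_(k < N) i (skew_coef k t) * x ^+ k.
Proof.
rewrite /skew_coef; set s := xchoose _; exists (size s) => N sN.
split; first by rewrite nth_default.
rewrite [LHS](eqP (xchooseP (skew_coefs_subproof t))) -/s.
rewrite (big_ord_widen N (fun k => i s`_k * x ^+ k)) // big_mkcond.
apply: eq_bigr => k _; case: ltnP => // sk.
by rewrite nth_default // (linearF0 lini) mul0r.
Qed.

(** Freeness applied to the difference of the two expansions, at one length exceeding [k] and both
    thresholds. *)
Lemma skew_coef_unique t (g : nat -> R) n :
  (forall N, (n <= N)%N -> t = \sum_(k < N) i (g k) * x ^+ k) ->
  forall k, skew_coef k t = g k.
Proof.
move=> tg k; have [m tE] := skew_coefE t.
pose N := maxn k.+1 (maxn n m).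
apply/eqP; rewrite -subr_eq0; apply/eqP.
apply: (@skew_free N (fun k => skew_coef k t - g k)); last by rewrite leq_max leqnn.
under eq_bigr => j _ do rewrite (linearFD lini) (linearFN _ lini) mulrDl mulNr.
rewrite sumrB -tg ?leq_max ?leqnn ?orbT //.
by rewrite -(tE N _).2 ?subrr // !leq_max leqnn !orbT.
Qed.

Lemma skew_coef_linear k : linearF (skew_coef k).
Proof.
move=> c t u; have [n tE] := skew_coefE t; have [m uE] := skew_coefE u.
apply: (@skew_coef_unique _ (fun k => c *: skew_coef k t + skew_coef k u)
  (maxn n m)) => N.
rewrite geq_max => /andP[nN mN].
rewrite {1}(tE N nN).2 {1}(uE N mN).2 scaler_sumr -big_split /=.
by apply: eq_bigr => j _; rewrite lini mulrDl scalerAl.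
Qed.

Lemma skew_coefM k r t : skew_coef k (i r * t) = r * skew_coef k t.
Proof.
have [n tE] := skew_coefE t.
apply: (@skew_coef_unique _ (fun k => r * skew_coef k t) n) => N nN.
rewrite {1}(tE N nN).2 mulr_sumr; apply: eq_bigr => j _.
by rewrite iM mulrA.
Qed.

Lemma skew_coef_const k r : skew_coef k (i r) = if k is 0 then r else 0.
Proof.
apply: (@skew_coef_unique _ (fun k => if k is 0 then r else 0) 1) => -[//|N] _.
rewrite big_ord_recl expr0 mulr1 big1 ?addr0 // => j _.
by rewrite (linearF0 lini) mul0r.
Qed.

Lemma skew_coefX k t : skew_coef k (x * t) =
  (if k is k'.+1 then sigma (skew_coef k' t) else 0) + delta (skew_coef k t).
Proof.
have [n tE] := skew_coefE t.
apply: (@skew_coef_unique _ (fun k =>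
  (if k is k'.+1 then sigma (skew_coef k' t) else 0) + delta (skew_coef k t))
  n.+1) => -[//|N] nN.
have ld : linearF delta by case: der.
rewrite {1}(tE N.+1 (leqW nN)).2 mulr_sumr.
under eq_bigr => j _ do
  rewrite mulrA (proj1 skewT) mulrDl -mulrA -exprS.
under [RHS]eq_bigr => j _ do rewrite (linearFD lini) mulrDl.
(* The [sigma] part is shifted by one: on the right its term of index 0 is zero, on the left its
   last term vanishes because the coefficient of index [N] does. *)
rewrite !big_split /=; congr (_ + _); rewrite [RHS]big_ord_recl.
rewrite (linearF0 lini) mul0r add0r big_ord_recr /= (tE N nN).1.
by rewrite (linearF0 lin_sigma) (linearF0 lini) mul0r addr0.
Qed.

Lemma skew_coef1 k : skew_coef k 1 = if k is 0 then 1 else 0.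
Proof. by rewrite -i1 skew_coef_const. Qed.

Lemma skew_coef_var k : skew_coef k x = (k == 1%N)%:R.
Proof.
have [ld dM] := der.
have d1 : delta 1 = 0.
  have := dM 1 1; rewrite !mulr1 sigma1 mul1r => h.
  by apply: (addrI (delta 1)); rewrite addr0 -h.
rewrite -[X in skew_coef k X]mulr1 skew_coefX !skew_coef1.
case: k => [|k]; first by rewrite d1 addr0.
by rewrite skew_coef1 (linearF0 ld) addr0; case: k => [|k]; rewrite ?sigma1 ?(linearF0 lin_sigma).
Qed.

Let ld : linearF delta. Proof. by case: der. Qed.

Lemma skew_coef_powerMr_gt r n k : (n < k)%N -> skew_coef k (x ^+ n * i r) = 0.
Proof.
elim: n k => [|n IH] [//|k] nk; first by rewrite expr0 mul1r skew_coef_const.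
rewrite exprS -mulrA skew_coefX !IH ?(ltnW nk) //.
by rewrite (linearF0 lin_sigma) (linearF0 ld) addr0.
Qed.

(** With [skew_coef_powerMr_gt] this is a triangularity statement: moving [r] to the left of
    [x ^+ n] changes only terms of lower degree, apart from the twist by [sigma^n]. *)
Lemma skew_coef_powerMr r n : skew_coef n (x ^+ n * i r) = iter n sigma r.
Proof.
elim: n => [|n IH]; first by rewrite expr0 mul1r skew_coef_const.
rewrite exprS -mulrA skew_coefX IH skew_coef_powerMr_gt //.
by rewrite (linearF0 ld) addr0.
Qed.

(** The coefficient of the top power is an iterate of [sigma] at [g n], so injectivity of [sigma]
    kills [g n] and the induction continues. This freeness on the right gives injectivity of the
    antipode of the extension. *)
Lemma skew_free_right : injective sigma ->
  forall n (g : nat -> R), \sum_(k < n) x ^+ k * i (g k) = 0 ->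
  forall k, (k < n)%N -> g k = 0.
Proof.
move=> sigma_inj.
have iter0 m r : iter m sigma r = 0 -> r = 0.
  elim: m => [//|m IHm] /=.
  by rewrite -[X in _ = X](linearF0 lin_sigma) => /sigma_inj/IHm.
elim=> [//|n IH] g; rewrite big_ord_recr /= => g0 k.
have gn0 : g n = 0.
  have := congr1 (skew_coef n) g0.
  rewrite (linearFD (skew_coef_linear n)) (linearFsum _ _ (skew_coef_linear n)).
  rewrite (linearF0 (skew_coef_linear n)) big1 => [|j _]; last first.
    by rewrite skew_coef_powerMr_gt.
  rewrite add0r skew_coef_powerMr => sg0.
  exact: (iter0 n).
rewrite ltnS leq_eqVlt => /predU1P[->//|]; apply: IH.
by rewrite -[RHS]g0 gn0 (linearF0 lini) mulr0 addr0.
Qed.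

(** * The change of variable [y = c x + d] with [c] a unit *)

Section ChangeOfVariable.
Variables c c' d : R.
Hypothesis cc' : c * c' = 1.
Hypothesis c'c : c' * c = 1.
Hypothesis sigma_bij : bijective sigma.
Let y := i c * x + i d.
(** Both [sigma'] and [delta'] are forced: substitute [x = c' (y - d)] in
    [y r = c sigma(r) x + c delta(r) + d r]. *)
Let sigma' r := c * sigma r * c'.
Let delta' r := c * delta r + d * r - c * sigma r * c' * d.

Lemma change_var_auto : alg_auto sigma'.
Proof.
rewrite /sigma'; do 2?split; first by lin.
- by move=> r s; rewrite sigmaM !mulrA -[_ * c' * c]mulrA c'c mulr1.
split; first by rewrite sigma1 mulr1 cc'.
have [tau sK tK] := sigma_bij; exists (fun r => tau (c' * r * c)) => r.
  by rewrite !mulrA c'c mul1r -mulrA c'c mulr1 sK.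
by rewrite tK !mulrA cc' mul1r -mulrA cc' mulr1.
Qed.

Lemma change_var_der : sigma_der sigma' delta'.
Proof.
rewrite /sigma' /delta'; split; first by lin.
move=> r s; rewrite (proj2 der) sigmaM !mulrDl !mulrDr !mulNr !mulrN !mulrA.
rewrite -[c * sigma r * c' * c]mulrA c'c mulr1.
by rewrite [RHS](AC (3*3) (1*4*2*6*(5*3))) /= subrr addr0.
Qed.

Lemma change_var_comm r : y * i r = i (sigma' r) * y + i (delta' r).
Proof.
rewrite /y /sigma' /delta' mulrDl -mulrA (proj1 skewT) !mulrDr.
rewrite !(linearFD lini) (linearFN _ lini) !iM !mulrA.
have c'cT : i c' * i c = 1 by rewrite -iM c'c i1.
rewrite -[i c * i (sigma r) * i c' * i c]mulrA c'cT mulr1 -!addrA; congr (_ + _).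
by rewrite [RHS]addrCA; congr (_ + _); rewrite addrCA subrr addr0.
Qed.

Let Ly k t : skew_coef k (y * t) =
  c * ((if k is k'.+1 then sigma (skew_coef k' t) else 0) + delta (skew_coef k t))
  + d * skew_coef k t.
Proof.
by rewrite /y mulrDl -mulrA (linearFD (skew_coef_linear k)) !skew_coefM skew_coefX.
Qed.

Lemma change_var_coef_gt n k : (n < k)%N -> skew_coef k (y ^+ n) = 0.
Proof.
elim: n k => [|n IH] [//|k] nk; first by rewrite expr0 skew_coef1.
rewrite exprS Ly (IH k) // (IH k.+1) ?(ltnW nk) //.
by rewrite (linearF0 lin_sigma) (linearF0 ld) addr0 !mulr0 addr0.
Qed.

(** The leading coefficient of [y ^+ n.+1] is [c] times [sigma] of that of [y ^+ n], so right
    inverses propagate; a right inverse is what cancels it from the leading term of a left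
    combination. *)
Lemma change_var_lead n : exists u, skew_coef n (y ^+ n) * u = 1.
Proof.
elim: n => [|n [u Lu]]; first by exists 1; rewrite expr0 skew_coef1 mulr1.
exists (sigma u * c'); rewrite exprS Ly (@change_var_coef_gt n n.+1) //.
rewrite (linearF0 ld) mulr0 !addr0 -mulrA [sigma _ * (_ * _)]mulrA -sigmaM Lu.
by rewrite sigma1 mul1r.
Qed.

Lemma change_var_free n (g : nat -> R) :
  \sum_(k < n) i (g k) * y ^+ k = 0 -> forall k, (k < n)%N -> g k = 0.
Proof.
elim: n => [//|n IH] in g *; rewrite big_ord_recr /= => g0 k.
have gn0 : g n = 0.
  have := congr1 (skew_coef n) g0; have lc := skew_coef_linear n.
  rewrite (linearFD lc) (linearFsum _ _ lc) (linearF0 lc) big1 => [|j _]; last first.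
    by rewrite skew_coefM change_var_coef_gt // mulr0.
  rewrite add0r skew_coefM; have [u Lu] := change_var_lead n.
  by move=> /(congr1 ( *%R^~ u)); rewrite -mulrA Lu mulr1 mul0r.
rewrite ltnS leq_eqVlt => /predU1P[->//|]; apply: IH.
by rewrite -[RHS]g0 gn0 (linearF0 lini) mul0r addr0.
Qed.

(** The polynomial serves as a finitely supported coefficient sequence, which makes adding
    expansions of different lengths painless. *)
Let spanned t := exists p : {poly R}, t = \sum_(k < size p) i p`_k * y ^+ k.

Let widen (p : {poly R}) N : (size p <= N)%N ->
  \sum_(k < size p) i p`_k * y ^+ k = \sum_(k < N) i p`_k * y ^+ k.
Proof.
move=> pN; rewrite (big_ord_widen N (fun k => i p`_k * y ^+ k)) // big_mkcond.
apply: eq_bigr => k _; case: ltnP => // sk.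
by rewrite nth_default // (linearF0 lini) mul0r.
Qed.

Let spannedD t u : spanned t -> spanned u -> spanned (t + u).
Proof.
move=> [p ->] [q ->]; exists (p + q); pose N := maxn (size p) (size q).
rewrite (@widen p N) ?leq_maxl // (@widen q N) ?leq_maxr //.
rewrite (@widen (p + q) N) ?size_polyD // -big_split; apply: eq_bigr => k _ /=.
by rewrite coefD (linearFD lini) mulrDl.
Qed.

Let spanned_power r k : spanned (i r * y ^+ k).
Proof.
exists (r *: 'X^k); rewrite (@widen _ k.+1); last first.
  by rewrite (leq_trans (size_scale_leq _ _)) // size_polyXn.
rewrite big_ord_recr /= big1 ?add0r => [|j _].
  by rewrite coefZ coefXn eqxx mulr1.
by rewrite coefZ coefXn ltn_eqF // mulr0 (linearF0 lini) mul0r.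
Qed.

Let spanned_sum n (g : 'I_n -> T) :
  (forall k, spanned (g k)) -> spanned (\sum_(k < n) g k).
Proof.
move=> h; apply: (big_ind spanned) => //; exists 0.
by rewrite size_poly0 big_ord0.
Qed.

Let spannedMl r t : spanned t -> spanned (i r * t).
Proof.
move=> [p ->]; rewrite mulr_sumr; apply: spanned_sum => k.
by rewrite mulrA -iM.
Qed.

(** Solve for [x] in terms of [y]; the span is stable under left multiplication by [y] thanks to
    [change_var_comm]. *)
Let spannedX t : spanned t -> spanned (x * t).
Proof.
have xE : x = i c' * y - i (c' * d).
  by rewrite /y mulrDr !mulrA -!iM c'c i1 mul1r addrK.
have Dy u : spanned u -> spanned (y * u).
  move=> [p ->]; rewrite mulr_sumr; apply: spanned_sum => k.
  rewrite mulrA change_var_comm mulrDl -mulrA -exprS.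
  by apply: spannedD.
move=> st; rewrite xE mulrBl -mulNr -(linearFN _ lini) -mulrA.
by apply: spannedD; apply: spannedMl => //; apply: Dy.
Qed.

Lemma change_var_skew : skew_poly i y sigma' delta'.
Proof.
split; first exact: change_var_comm; split.
  move=> t; have: spanned t; last by move=> [p ->]; exists p.
  have [s ->] := proj1 (proj2 skewT) t; apply: spanned_sum => k.
  apply: spannedMl; elim: (k : nat) => [|m IH].
    by have := spanned_power 1 0; rewrite i1 mul1r.
  by rewrite exprS; apply: spannedX.
move=> s s0; apply/(all_nthP 0) => k ks; apply/eqP.
exact: (@change_var_free (size s) (fun k => s`_k)).
Qed.

End ChangeOfVariable.
End Skew.

(** * Hopf Ore extensions *)

Section HopfOre.
Variables (F : fieldType) (R T : algType F).
Variables (DR : R -> seq (R * R)) (eR : R -> F) (SR : R -> R).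
Variables (DT : T -> seq (T * T)) (eT : T -> F) (ST : T -> T).
Variables (i : R -> T) (x : T) (sigma delta : R -> R).
Variables (a b : R) (v w : seq (R * R)).
Hypothesis hoe : HOE DR eR SR DT eT ST i x sigma delta a b v w.

Lemma HOE_hopfR : is_hopf DR eR SR. Proof. by case: hoe. Qed.
Lemma HOE_hopfT : is_hopf DT eT ST. Proof. by case: hoe => _ []. Qed.
Lemma HOE_lin : linearF i. Proof. by case: hoe => _ [_ [[_ []]]]. Qed.
Lemma HOE_morphM r s : i (r * s) = i r * i s.
Proof. by case: hoe => _ [_ [[_ [_ []]]]]. Qed.
Lemma HOE_morph1 : i 1 = 1.
Proof. by case: hoe => _ [_ [[_ [_ [_ []]]]]]. Qed.
Lemma HOE_comul r : teq2 (DT (i r)) (tmap i (DR r)).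
Proof. by case: hoe => _ [_ [[_ [_ [_ [_ /(_ r)[]]]]]]]. Qed.
Lemma HOE_counit r : eT (i r) = eR r.
Proof. by case: hoe => _ [_ [[_ [_ [_ [_ /(_ r)[_ []]]]]]]]. Qed.
Lemma HOE_antipode r : ST (i r) = i (SR r).
Proof. by case: hoe => _ [_ [[_ [_ [_ [_ /(_ r)[_ []]]]]]]]. Qed.
Lemma HOE_auto : alg_auto sigma. Proof. by case: hoe => _ [_ [_ []]]. Qed.
Lemma HOE_der : sigma_der sigma delta.
Proof. by case: hoe => _ [_ [_ [_ []]]]. Qed.
Lemma HOE_skew : skew_poly i x sigma delta.
Proof. by case: hoe => _ [_ [_ [_ [_ []]]]]. Qed.

Let lini := HOE_lin.
Let iM := HOE_morphM.
Let i1 := HOE_morph1.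
Let linDR := hopf_linD HOE_hopfR.
Let linDT := hopf_linD HOE_hopfT.
Let lineR := hopf_lin_counit HOE_hopfR.
Let lineT := hopf_lin_counit HOE_hopfT.
Let linSR := hopf_lin_antipode HOE_hopfR.
Let linST := hopf_lin_antipode HOE_hopfT.
Let lin_sigma : linearF sigma. Proof. by case: HOE_auto. Qed.
Let sigmaM r s : sigma (r * s) = sigma r * sigma s.
Proof. by case: HOE_auto => _ []. Qed.
Let sigma1 : sigma 1 = 1. Proof. by case: HOE_auto => _ [_ []]. Qed.
Let sigma_bij : bijective sigma. Proof. by case: HOE_auto => _ [_ []]. Qed.
Let lin_delta : linearF delta. Proof. by case: HOE_der. Qed.

Notation c := (skew_coef HOE_skew).

Let linc k : linearF (c k). Proof. exact: skew_coef_linear. Qed.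
Let cM k r t : c k (i r * t) = r * c k t. Proof. exact: skew_coefM. Qed.
Let ci k r : c k (i r) = if k is 0 then r else 0.
Proof. exact: skew_coef_const. Qed.
Let cX k t : c k (x * t) =
  (if k is k'.+1 then sigma (c k' t) else 0) + delta (c k t).
Proof. by apply: skew_coefX => //; exact: HOE_der. Qed.
Let cx k : c k x = (k == 1%N)%:R. Proof. by apply: skew_coef_var => //; exact: HOE_der. Qed.
Let lin0 := linc 0.
Let lin1 := linc 1.

(** * Coefficients of the comultiplication and of coassociativity at [x] *)

Lemma HOE_sum_comul r (Z : lmodType F) (f : T -> T -> Z) : bilinear_map f ->
  \sum_(p <- DT (i r)) f p.1 p.2 = \sum_(p <- DR r) f (i p.1) (i p.2).
Proof. by move=> hf; rewrite (HOE_comul r hf) sum_tmap. Qed.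

Lemma HOE_sum_comulX (Z : lmodType F) (f : T -> T -> Z) : bilinear_map f ->
  \sum_(p <- DT x) f p.1 p.2 = f (i a) x + f x (i b)
  + \sum_(p <- v) f (i p.1 * x) (i p.2 * x) + \sum_(p <- w) f (i p.1) (i p.2).
Proof.
case: hoe => _ [_ [_ [_ [_ [_ h]]]]] hf.
by rewrite (h _ _ hf) !big_cat /= big_map sum_tmap !big_cons big_nil addr0 !addrA.
Qed.

Let bil0l (Z : lmodType F) (f : R -> R -> Z) u : bilinear_map f -> f 0 u = 0.
Proof. by move=> hf; apply: (linearF0 (g := fun v => f v u)); lin. Qed.
Let bil0r (Z : lmodType F) (f : R -> R -> Z) u : bilinear_map f -> f u 0 = 0.
Proof. by move=> hf; apply: (linearF0 (g := f u)); lin. Qed.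

(** Testing against [f (c j _) (c k _)] isolates the coefficient of [x^j (x) x^k] in [Delta(x)]:
    [i r] has only a constant coefficient and [i r * x] only a linear one. The next three lemmas
    treat the other [j, k <= 1] in the same way. *)
Lemma comulX_coef00 (Z : lmodType F) (f : R -> R -> Z) : bilinear_map f ->
  \sum_(p <- DT x) f (c 0 p.1) (c 0 p.2) = \sum_(p <- w) f p.1 p.2.
Proof.
move=> hf; rewrite (@HOE_sum_comulX _ (fun u v => f (c 0 u) (c 0 v))); last by lin.
rewrite !cx !ci /= bil0l ?bil0r // !add0r [X in X + _]big1 ?add0r => [|p _].
  by apply: eq_bigr => p _; rewrite !ci.
by rewrite !cM cx mulr0 bil0l.
Qed.

Lemma comulX_coef01 (Z : lmodType F) (f : R -> R -> Z) : bilinear_map f ->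
  \sum_(p <- DT x) f (c 0 p.1) (c 1 p.2) = f a 1.
Proof.
move=> hf; rewrite (@HOE_sum_comulX _ (fun u v => f (c 0 u) (c 1 v))); last by lin.
rewrite !cx !ci /= bil0l // addr0 big1 ?addr0 => [|p _].
  by rewrite big1 ?addr0 // => p _; rewrite !ci bil0r.
by rewrite !cM cx mulr0 bil0l.
Qed.

Lemma comulX_coef10 (Z : lmodType F) (f : R -> R -> Z) : bilinear_map f ->
  \sum_(p <- DT x) f (c 1 p.1) (c 0 p.2) = f 1 b.
Proof.
move=> hf; rewrite (@HOE_sum_comulX _ (fun u v => f (c 1 u) (c 0 v))); last by lin.
rewrite !cx !ci /= bil0l // add0r big1 ?addr0 => [|p _].
  by rewrite big1 ?addr0 // => p _; rewrite !ci bil0l.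
by rewrite !cM !cx mulr0 bil0r.
Qed.

Lemma comulX_coef11 (Z : lmodType F) (f : R -> R -> Z) : bilinear_map f ->
  \sum_(p <- DT x) f (c 1 p.1) (c 1 p.2) = \sum_(p <- v) f p.1 p.2.
Proof.
move=> hf; rewrite (@HOE_sum_comulX _ (fun u v => f (c 1 u) (c 1 v))); last by lin.
rewrite !cx !ci /= bil0l // bil0r // !add0r [X in _ + X]big1 ?addr0 => [|p _].
  by apply: eq_bigr => p _; rewrite !cM !cx !mulr1.
by rewrite !ci bil0l.
Qed.

(** The formula for [Delta(x)] is substituted in the outer comultiplication only; the inner sums
    over [DT x] are kept, so that the [comulX_coef] lemmas apply to them. *)
Lemma coassocX (Z : lmodType F) (f : T -> T -> T -> Z) : trilinear_map f ->
  \sum_(q <- DR a) f (i q.1) (i q.2) x + \sum_(q <- DT x) f q.1 q.2 (i b)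
  + \sum_(p <- v) \sum_(q <- DR p.1) \sum_(y <- DT x)
      f (i q.1 * y.1) (i q.2 * y.2) (i p.2 * x)
  + \sum_(p <- w) \sum_(q <- DR p.1) f (i q.1) (i q.2) (i p.2) =
  \sum_(q <- DT x) f (i a) q.1 q.2 + \sum_(q <- DR b) f x (i q.1) (i q.2)
  + \sum_(p <- v) \sum_(q <- DR p.2) \sum_(y <- DT x)
      f (i p.1 * x) (i q.1 * y.1) (i q.2 * y.2)
  + \sum_(p <- w) \sum_(q <- DR p.2) f (i p.1) (i q.1) (i q.2).
Proof.
move=> hf.
have := coassoc HOE_hopfT x hf.
rewrite (@HOE_sum_comulX _ (fun u v => \sum_(q <- DT u) f q.1 q.2 v)); last by lin.
rewrite (@HOE_sum_comulX _ (fun u v => \sum_(q <- DT v) f u q.1 q.2)); last by lin.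
rewrite (@HOE_sum_comul _ _ (fun u v => f u v x)); last by lin.
rewrite (@HOE_sum_comul _ _ (fun u v => f x u v)); last by lin.
have e1 (p : R * R) : \sum_(q <- DT (i p.1 * x)) f q.1 q.2 (i p.2 * x) =
    \sum_(q <- DR p.1) \sum_(y <- DT x) f (i q.1 * y.1) (i q.2 * y.2) (i p.2 * x).
  rewrite (@sum_DM _ _ _ _ _ HOE_hopfT _ (fun u v => f u v (i p.2 * x))); last by lin.
  by rewrite (@HOE_sum_comul _ _ (fun u v => \sum_(y <- DT x)
    f (u * y.1) (v * y.2) (i p.2 * x))) //; lin.
have e2 (p : R * R) : \sum_(q <- DT (i p.2 * x)) f (i p.1 * x) q.1 q.2 =
    \sum_(q <- DR p.2) \sum_(y <- DT x) f (i p.1 * x) (i q.1 * y.1) (i q.2 * y.2).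
  rewrite (@sum_DM _ _ _ _ _ HOE_hopfT _ (fun u v => f (i p.1 * x) u v)); last by lin.
  by rewrite (@HOE_sum_comul _ _ (fun u v => \sum_(y <- DT x)
    f (i p.1 * x) (u * y.1) (v * y.2))) //; lin.
have e3 (p : R * R) : \sum_(q <- DT (i p.1)) f q.1 q.2 (i p.2) =
    \sum_(q <- DR p.1) f (i q.1) (i q.2) (i p.2).
  by apply: (@HOE_sum_comul _ _ (fun u v => f u v (i p.2))); lin.
have e4 (p : R * R) : \sum_(q <- DT (i p.2)) f (i p.1) q.1 q.2 =
    \sum_(q <- DR p.2) f (i p.1) (i q.1) (i q.2).
  by apply: (@HOE_sum_comul _ _ (fun u v => f (i p.1) u v)); lin.
by rewrite (eq_bigr _ (fun p _ => e1 p)) (eq_bigr _ (fun p _ => e2 p))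
  (eq_bigr _ (fun p _ => e3 p)) (eq_bigr _ (fun p _ => e4 p)).
Qed.

Let counitR_bil (Z : lmodType F) (f : R -> Z) r : linearF f ->
  \sum_(p <- DR r) eR p.2 *: f p.1 = f r.
Proof. exact: (counitr_lin HOE_hopfR). Qed.

(* Coassociativity at [x], coefficient [x^0 (x) x^0 (x) x^1], then counit on the
   last factor. *)
Lemma comul_a (Z : lmodType F) (f : R -> R -> Z) : bilinear_map f ->
  \sum_(q <- DR a) f q.1 q.2 + \sum_(p <- v) \sum_(q <- DR p.1) \sum_(y <- w)
    eR p.2 *: f (q.1 * y.1) (q.2 * y.2) = f a a.
Proof.
move=> hf.
have hF : trilinear_map (fun u1 u2 u3 => eR (c 1 u3) *: f (c 0 u1) (c 0 u2)) by lin.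
have := coassocX hF.
rewrite [X in _ + X + _ + _ = _]big1 => [|p _]; last first.
  by rewrite ci (linformF0 lineR) scale0r.
rewrite [X in _ + X = _]big1 => [|p _]; last first.
  by rewrite big1 // => q _; rewrite ci (linformF0 lineR) scale0r.
rewrite [X in _ = _ + X + _ + _]big1 => [|p _]; last first.
  by rewrite ci (linformF0 lineR) scale0r.
rewrite [X in _ = _ + X + _]big1 => [|p _]; last first.
  rewrite big1 // => q _; rewrite big1 // => y _.
  by rewrite !cM cx mulr0 bil0l // scaler0.
rewrite [X in _ = _ + X]big1 => [|p _]; last first.
  by rewrite big1 // => q _; rewrite ci (linformF0 lineR) scale0r.
rewrite !addr0 (@comulX_coef01 _ (fun u u' => eR u' *: f (c 0 (i a)) u)); last by lin.
rewrite (counit1 HOE_hopfR) scale1r ci => <-; congr (_ + _).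
  by apply: eq_bigr => q _; rewrite !ci cx (counit1 HOE_hopfR) scale1r.
apply: eq_bigr => p _; apply: eq_bigr => q _.
rewrite -(@comulX_coef00 _ (fun u u' => eR p.2 *: f (q.1 * u) (q.2 * u'))); last by lin.
by apply: eq_bigr => y _; rewrite !cM cx mulr1.
Qed.

(** Mirror image of [comul_a]: the coefficient of [x^1 (x) x^0 (x) x^0], with the counit on the
    first factor. *)
Lemma comul_b (Z : lmodType F) (f : R -> R -> Z) : bilinear_map f ->
  \sum_(q <- DR b) f q.1 q.2 + \sum_(p <- v) \sum_(q <- DR p.2) \sum_(y <- w)
    eR p.1 *: f (q.1 * y.1) (q.2 * y.2) = f b b.
Proof.
move=> hf.
have hF : trilinear_map (fun u1 u2 u3 => eR (c 1 u1) *: f (c 0 u2) (c 0 u3)) by lin.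
have := coassocX hF.
rewrite [X in X + _ + _ + _ = _]big1 => [|p _]; last first.
  by rewrite ci (linformF0 lineR) scale0r.
rewrite [X in _ + X = _]big1 => [|p _]; last first.
  by rewrite big1 // => q _; rewrite ci (linformF0 lineR) scale0r.
rewrite [X in _ + X + _ = _]big1 => [|p _]; last first.
  rewrite big1 // => q _; rewrite big1 // => y _.
  by rewrite !cM cx mulr0 bil0r // scaler0.
rewrite [X in _ = X + _ + _ + _]big1 => [|p _]; last first.
  by rewrite ci (linformF0 lineR) scale0r.
rewrite [X in _ = _ + X]big1 => [|p _]; last first.
  by rewrite big1 // => q _; rewrite ci (linformF0 lineR) scale0r.
rewrite !addr0 !add0r (@comulX_coef10 _ (fun u u' => eR u *: f u' (c 0 (i b)))); last by lin.
rewrite (counit1 HOE_hopfR) scale1r ci => ->; congr (_ + _).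
  by apply: eq_bigr => q _; rewrite !ci cx (counit1 HOE_hopfR) scale1r.
apply: eq_bigr => p _; apply: eq_bigr => q _.
rewrite -(@comulX_coef00 _ (fun u u' => eR p.1 *: f (q.1 * u) (q.2 * u'))); last by lin.
by apply: eq_bigr => y _; rewrite !cM cx mulr1.
Qed.

(** The coefficient of [x^0 (x) x^1 (x) x^1], with the counit on the middle factor. The left side
    comes from [v] and the term [a (x) x] of the inner [Delta(x)], the right side from
    [a (x) Delta(x)]. *)
Lemma comul_v (Z : lmodType F) (f : R -> R -> Z) : bilinear_map f ->
  \sum_(p <- v) f (p.1 * a) p.2 = \sum_(p <- v) eR p.1 *: f a p.2.
Proof.
move=> hf.
have hF : trilinear_map (fun u1 u2 u3 => eR (c 1 u2) *: f (c 0 u1) (c 1 u3)) by lin.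
have := coassocX hF.
rewrite [X in X + _ + _ + _ = _]big1 => [|p _]; last first.
  by rewrite ci (linformF0 lineR) scale0r.
rewrite [X in _ + X + _ + _ = _]big1 => [|p _]; last first.
  by rewrite ci bil0r // scaler0.
rewrite [X in _ + X = _]big1 => [|p _]; last first.
  by rewrite big1 // => q _; rewrite ci (linformF0 lineR) scale0r.
rewrite [X in _ = _ + X + _ + _]big1 => [|p _]; last first.
  by rewrite ci (linformF0 lineR) scale0r.
rewrite [X in _ = _ + X + _]big1 => [|p _]; last first.
  rewrite big1 // => q _; rewrite big1 // => y _.
  by rewrite !cM cx mulr0 bil0l // scaler0.
rewrite [X in _ = _ + X]big1 => [|p _]; last first.
  by rewrite big1 // => q _; rewrite ci (linformF0 lineR) scale0r.
rewrite !addr0 !add0r (@comulX_coef11 _ (fun u u' => eR u *: f (c 0 (i a)) u')); last by lin.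
rewrite ci => <-; apply: eq_bigr => p _.
rewrite -(@counitR_bil _ (fun r => f (r * a) p.2)); last by lin.
apply: eq_bigr => q _.
have := @comulX_coef01 _ (fun u u' => eR (q.2 * u') *: f (q.1 * u) p.2).
rewrite mulr1 => <-; last by lin.
by apply: eq_bigr => y _; rewrite !cM cx mulr1.
Qed.

(** * Consequences of (H): [a] and [b] are group-like and [v = 0] *)

Section AntipodeCondition.
Variables (alpha alpha' beta : R).
Hypothesis alphaK : alpha' * alpha = 1.
Hypothesis STx : ST x = i alpha * x + i beta.

(** The left antipode axiom at [x]. Since [S] reverses products, the [v] part is [S(x)] times
    [sum S(v_1) v_2] times [x]; then [S(x)] is replaced by [alpha x + beta]. *)
Lemma antipode_coef k :
  c k (i (SR a) * x + i alpha * (x * i b) + i beta * i b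
    + (i alpha * (x * (i (\sum_(p <- v) SR p.1 * p.2) * x))
       + i beta * (i (\sum_(p <- v) SR p.1 * p.2) * x))
    + i (\sum_(p <- w) SR p.1 * p.2)) = if k is 0 then eT x *: 1 else 0.
Proof.
have <- : c k (i (eT x *: 1)) = if k is 0 then eT x *: 1 else 0 by rewrite ci.
congr (c k _); rewrite (linearFZ _ _ lini) i1 -(antipodel HOE_hopfT).
rewrite (@HOE_sum_comulX _ (fun u u' => ST u * u')); last by lin.
congr (_ + _ + _).
- by rewrite HOE_antipode STx mulrDl !mulrA addrA.
- rewrite (linearFsum _ _ lini) mulr_suml !mulr_sumr -big_split /=.
  apply: eq_bigr => p _; rewrite (antipodeM HOE_hopfT) HOE_antipode STx iM.
  by rewrite !mulrDl !mulrA.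
by rewrite (linearFsum _ _ lini); apply: eq_bigr => p _; rewrite iM HOE_antipode.
Qed.

(** The only contribution to the coefficient of [x^2] is [alpha] times [sigma] of this sum; [alpha]
    is cancelled on the left and [sigma] is injective. *)
Lemma sum_antipode_v : \sum_(p <- v) SR p.1 * p.2 = 0.
Proof.
have := antipode_coef 2; rewrite !(linearFD (linc 2)) !cM !cX !cM !ci !cx /=.
rewrite !mulr0 !mulr1 !(linearF0 lin_sigma) !(linearF0 lin_delta).
rewrite !(addr0, add0r, mulr0).
move=> /(congr1 ( *%R alpha')); rewrite mulrA alphaK mul1r mulr0.
by rewrite -[X in _ = X](linearF0 lin_sigma) => /(bij_inj sigma_bij).
Qed.

Lemma antipode_a : SR a + alpha * sigma b = 0.
Proof.
have := antipode_coef 1; rewrite sum_antipode_v (linearF0 lini) !mul0r !mulr0.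
rewrite !(linearFD (linc 1)) !cM !cX !ci !cx /=.
by rewrite (linearF0 lin1) (linearF0 lin_delta) !(mulr0, mulr1, addr0).
Qed.

Lemma counit_v : \sum_(p <- v) eR p.1 * eR p.2 = 0.
Proof.
have := congr1 eR sum_antipode_v; rewrite (linformF0 lineR) (linformFsum _ _ lineR).
move=> h; rewrite -[RHS]h; apply: eq_bigr => p _.
by rewrite (counitM HOE_hopfR) (counit_antipode HOE_hopfR).
Qed.

(** The coefficient of [x] in the left counit axiom, followed by the counit, gives [eps(a) + eps(x)
    sum eps(v_1) eps(v_2) = 1]; the sum is zero by [counit_v]. *)
Lemma counit_a : eR a = 1.
Proof.
have := congr1 (fun t => eR (c 1 t)) (counitl HOE_hopfT x).
rewrite cx (counit1 HOE_hopfR) => <-.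
rewrite (@HOE_sum_comulX _ (fun u u' => eT u *: u')); last by lin.
rewrite !(linearFD lin1) !(linearFZ _ _ lin1) !(linearFsum _ _ lin1) ci cx.
rewrite scaler0 addr0 [X in _ + X]big1 ?addr0 => [|p _]; last first.
  by rewrite (linearFZ _ _ lin1) ci scaler0.
rewrite (linformFD lineR) (linformFZ _ _ lineR) (linformFsum _ _ lineR).
rewrite (counit1 HOE_hopfR) HOE_counit mulr1 (eq_bigr (fun p => eT x * (eR p.1 * eR p.2))).
  by rewrite -mulr_sumr counit_v mulr0 addr0.
move=> p _; rewrite (linearFZ _ _ lin1) cM cx mulr1 (linformFZ _ _ lineR).
by rewrite (counitM HOE_hopfT) HOE_counit -mulrA mulrCA.
Qed.

Lemma counit_b : eR b = 1.
Proof.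
have := congr1 (fun t => eR (c 1 t)) (counitr HOE_hopfT x).
rewrite cx (counit1 HOE_hopfR) => <-.
rewrite (@HOE_sum_comulX _ (fun u u' => eT u' *: u)); last by lin.
rewrite !(linearFD lin1) !(linearFZ _ _ lin1) !(linearFsum _ _ lin1) ci cx.
rewrite scaler0 add0r [X in _ + X]big1 ?addr0 => [|p _]; last first.
  by rewrite (linearFZ _ _ lin1) ci scaler0.
rewrite (linformFD lineR) (linformFZ _ _ lineR) (linformFsum _ _ lineR).
rewrite (counit1 HOE_hopfR) HOE_counit mulr1 (eq_bigr (fun p => eT x * (eR p.1 * eR p.2))).
  by rewrite -mulr_sumr counit_v mulr0 addr0.
move=> p _; rewrite (linearFZ _ _ lin1) cM cx mulr1 (linformFZ _ _ lineR).
by rewrite (counitM HOE_hopfT) HOE_counit [eR _ * eT x]mulrC -mulrA [eR p.2 * _]mulrC.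
Qed.

(** In [S(u_1 w_1) u_2 w_2] the factors [S(u_1) u_2] become adjacent once [S] reverses the product.
    This evaluates the correction terms of [comul_a] and [comul_b]. *)
Let antipode_conv u : \sum_(q <- DR u) \sum_(y <- w)
  SR (q.1 * y.1) * (q.2 * y.2) = eR u *: \sum_(y <- w) SR y.1 * y.2.
Proof.
rewrite exchange_big scaler_sumr; apply: eq_bigr => y _.
transitivity (SR y.1 * (\sum_(q <- DR u) SR q.1 * q.2) * y.2).
  rewrite mulr_sumr mulr_suml; apply: eq_bigr => q _.
  by rewrite (antipodeM HOE_hopfR) !mulrA.
by rewrite (antipodel HOE_hopfR) -scalerAr mulr1 -scalerAl.
Qed.

(** Apply [S (x) id] and multiply in [comul_a]: the first term is [eps(a) = 1], and the correction
    is a multiple of [sum eps(v_1) eps(v_2) = 0]. *)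
Lemma antipode_a_inv : SR a * a = 1.
Proof.
rewrite -(@comul_a _ (fun u u' => SR u * u')); last by lin.
rewrite (antipodel HOE_hopfR) counit_a scale1r -[RHS]addr0; congr (_ + _).
under eq_bigr => p _ do
  under eq_bigr => q _ do rewrite -scaler_sumr.
under eq_bigr => p _ do
  rewrite -scaler_sumr antipode_conv scalerA mulrC.
by rewrite -scaler_suml counit_v scale0r.
Qed.

Lemma antipode_b_inv : SR b * b = 1.
Proof.
rewrite -(@comul_b _ (fun u u' => SR u * u')); last by lin.
rewrite (antipodel HOE_hopfR) counit_b scale1r -[RHS]addr0; congr (_ + _).
under eq_bigr => p _ do
  under eq_bigr => q _ do rewrite -scaler_sumr.
under eq_bigr => p _ do
  rewrite -scaler_sumr antipode_conv scalerA.
by rewrite -scaler_suml counit_v scale0r.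
Qed.

Let inv_uniq (A : pzRingType) (u u' u'' : A) : u' * u = 1 -> u * u'' = 1 -> u * u' = 1.
Proof.
move=> h h'; suff -> : u' = u'' by [].
by rewrite -[u']mulr1 -h' mulrA h mul1r.
Qed.

(* From [S a = - alpha * sigma b] and [S a * a = 1], the element [sigma b] has a
   right inverse, hence so has [b]. *)
Lemma inv_b : b * SR b = 1.
Proof.
have [tau sK tK] := sigma_bij.
(* Since [sigma b = - alpha' * S a], a right inverse of [sigma b] is [- (a * alpha)]; the witness is
   its preimage under [sigma]. *)
apply: (inv_uniq antipode_b_inv (u'' := tau (- (a * alpha)))).
apply: (bij_inj sigma_bij); rewrite sigmaM tK sigma1.
have Sa : alpha * sigma b = - SR a.
  by apply/eqP; rewrite -addr_eq0 addrC antipode_a.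
have -> : sigma b = - (alpha' * SR a) by rewrite -mulrN -Sa mulrA alphaK mul1r.
by rewrite mulrNN mulrA -[alpha' * _ * _]mulrA antipode_a_inv mulr1.
Qed.

(** Multiplying [S a * a = 1] on the left by [sigma (S b) * alpha'] yields
    [- a = sigma (S b) * alpha'], and [S a = - alpha * sigma b] cancels this from the right. *)
Lemma inv_a : a * SR a = 1.
Proof.
have Sa : SR a = - (alpha * sigma b) by apply/eqP; rewrite -addr_eq0 antipode_a.
have sb : sigma b * sigma (SR b) = 1 by rewrite -sigmaM inv_b sigma1.
have := antipode_a_inv; rewrite Sa => /(congr1 (fun u => sigma (SR b) * (alpha' * u))).
rewrite !mulNr -[alpha * _ * _]mulrA 2!mulrN [alpha' * (alpha * _)]mulrA alphaK mul1r.
rewrite [sigma (SR b) * (sigma b * a)]mulrA -sigmaM antipode_b_inv sigma1 mul1r mulr1 => aE.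
rewrite mulrN -mulNr aE mulrA -[_ * alpha' * _]mulrA alphaK mulr1.
by rewrite -sigmaM antipode_b_inv sigma1.
Qed.

(** With [a] cancelled in the first factor, [comul_v] reads [v = 1 (x) v']. It is used twice: with
    [S u * u'] to get [v' = 0], then with an arbitrary bilinear map. *)
Lemma v_eq0 : teq2 v [::].
Proof.
have V'0 : \sum_(p <- v) eR p.1 *: p.2 = 0.
  have := @comul_v _ (fun u u' => SR (u * SR a) * u').
  under eq_bigr => p _ do rewrite -mulrA inv_a mulr1.
  rewrite sum_antipode_v => h; rewrite [RHS]h; last by lin.
  by apply: eq_bigr => p _; rewrite inv_a (antipode1 HOE_hopfR) mul1r.
move=> Z f hf; rewrite big_nil.
have := @comul_v _ (fun u u' => f (u * SR a) u').
under eq_bigr => p _ do rewrite -mulrA inv_a mulr1.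
move=> ->; last by lin.
have l1 : linearF (f 1) by lin.
rewrite inv_a -[RHS](bil0r 1 hf) -[X in _ = f 1 X]V'0 (linearFsum _ _ l1).
by apply: eq_bigr => p _; rewrite (linearFZ _ _ l1).
Qed.

Lemma grouplike_a : grouplike DR a.
Proof.
split; last first.
  by apply/eqP => a0; move/eqP: antipode_a_inv; rewrite a0 mulr0 eq_sym oner_eq0.
move=> Z f hf; rewrite big_seq1 /= -comul_a //.
rewrite (v_eq0 (f := fun u u' => \sum_(q <- DR u) \sum_(y <- w)
  eR u' *: f (q.1 * y.1) (q.2 * y.2))); last by lin.
by rewrite big_nil addr0.
Qed.

Lemma grouplike_b : grouplike DR b.
Proof.
split; last first.
  by apply/eqP => b0; move/eqP: antipode_b_inv; rewrite b0 mulr0 eq_sym oner_eq0.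
move=> Z f hf; rewrite big_seq1 /= -comul_b //.
rewrite (v_eq0 (f := fun u u' => \sum_(q <- DR u') \sum_(y <- w)
  eR u *: f (q.1 * y.1) (q.2 * y.2))); last by lin.
by rewrite big_nil addr0.
Qed.

Let bV : SR b * b = 1 := antipode_b_inv.
Let Vb : b * SR b = 1 := inv_b.
Let eb : eR (SR b) = 1.
Proof. by rewrite (counit_antipode HOE_hopfR) counit_b. Qed.

(* The new variable is [b^-1 x - eps(x)]. *)
Lemma normalized_variable :
  exists (k k' d : R) (sigma' delta' : R -> R) (a' : R) (w' : seq (R * R)),
    k * k' = 1 /\ k' * k = 1 /\
    let x' := i k * x + i d in
    skew_poly i x' sigma' delta' /\ alg_auto sigma' /\ sigma_der sigma' delta' /\
    eT x' = 0 /\ teq2 (DT x') ([:: (i a', x'); (x', 1)] ++ tmap i w').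
Proof.
pose d := - (eT x *: 1) : R.
(* Writing [b^-1 x = x' + eps(x)] in [(b^-1 (x) b^-1) Delta(x)] produces the extra term
   [eps(x) b^-1 a (x) 1], which goes into [w'], and [eps(x) 1 (x) 1], which cancels against
   [Delta(d)]. *)
exists (SR b), b, d, (fun r => SR b * sigma r * b),
  (fun r => SR b * delta r + d * r - SR b * sigma r * b * d), (SR b * a),
  ((eT x *: (SR b * a), 1) :: [seq (SR b * p.1, SR b * p.2) | p <- w]).
do 2![split=> //]; cbv zeta.
split; first by apply: change_var_skew => //; [exact: HOE_der | exact: HOE_skew].
split; first by apply: change_var_auto.
split; first by apply: change_var_der => //; exact: HOE_der.
split.
  rewrite (linformFD lineT) (counitM HOE_hopfT) !HOE_counit eb mul1r.
  by rewrite (linformFN _ lineR) (linformFZ _ _ lineR) (counit1 HOE_hopfR) mulr1 subrr.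
move=> Z f hf; rewrite big_cat sum_tmap /= !big_cons !big_nil /= big_map addr0.
have fDl y z u : f (y + z) u = f y u + f z u.
  by apply: (linearFD (g := fun v => f v u)); lin.
have fDr y z u : f u (y + z) = f u y + f u z by apply: (linearFD (g := f u)); lin.
have fNl y u : f (- y) u = - f y u by apply: (linearFN (g := fun v => f v u)); lin.
have fNr y u : f u (- y) = - f u y by apply: (linearFN (g := f u)); lin.
have fZl l y u : f (l *: y) u = l *: f y u.
  by apply: (linearFZ (g := fun v => f v u)); lin.
have fZr l y u : f u (l *: y) = l *: f u y by apply: (linearFZ (g := f u)); lin.
have := linDT 1 (i (SR b) * x) (i d) hf; rewrite scale1r => ->.
rewrite big_cat /= (sum_tscale _ _ hf) scale1r (HOE_sum_comul _ hf).
rewrite (sum_DM HOE_hopfT _ _ hf).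
rewrite (@HOE_sum_comul _ _ (fun u v => \sum_(q <- DT x) f (u * q.1) (v * q.2))); last by lin.
rewrite (grouplikeV HOE_hopfR (proj1 grouplike_b) Vb bV
  (f := fun u v => \sum_(q <- DT x) f (i u * q.1) (i v * q.2))); last by lin.
rewrite big_seq1 /= (@HOE_sum_comulX _ (fun u v => f (i (SR b) * u) (i (SR b) * v))); last by lin.
rewrite (v_eq0 (f := fun p q => f (i (SR b) * (i p * x)) (i (SR b) * (i q * x)))); last by lin.
rewrite big_nil addr0 -!iM bV i1.
have -> : \sum_(p <- DR d) f (i p.1) (i p.2) = - (eT x *: f 1 1).
  rewrite /d -scaleNr.
  have lg : linearF (fun u => \sum_(p <- DR u) f (i p.1) (i p.2)) by lin.
  rewrite (linearFZ _ _ lg) scaleNr; congr (- (_ *: _)).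
  have hfi : bilinear_map (fun u v => f (i u) (i v)) by lin.
  by have := teq2_D1 HOE_hopfR hfi; rewrite big_seq1 /= i1.
have idE : i d = - (eT x *: 1).
  by rewrite /d (linearFN _ lini) (linearFZ _ _ lini) i1.
rewrite idE (linearFZ _ _ lini).
rewrite !fDl !fDr !fNl !fNr !fZl !fZr.
under [X in _ = _ + (_ + X)]eq_bigr => p _ do rewrite !iM.
by rewrite [RHS](AC ((2*2)*2) (1*3*6*4*(5*2))) /= subrr addr0.
Qed.

(** * Conditions (c) to (f) for a normalized variable *)

Section Normalized.
Hypothesis b1 : b = 1.
Hypothesis v0 : v = [::].
Hypothesis eTx : eT x = 0.

Let aK : SR a * a = 1 := antipode_a_inv.
Let Ka : a * SR a = 1 := inv_a.

(** The right antipode axiom at [x] reads [a S(x) + x + sum w_1 S(w_2) = 0]. *)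
Lemma antipode_var :
  ST x = - (i (SR a) * (x + i (\sum_(p <- w) p.1 * SR p.2))).
Proof.
have := antipoder HOE_hopfT x.
rewrite (@HOE_sum_comulX _ (fun u u' => u * ST u')); last by lin.
rewrite v0 big_nil addr0 b1 HOE_antipode (antipode1 HOE_hopfR) i1 mulr1.
rewrite eTx scale0r => h.
have {h} h : i a * ST x = - (x + i (\sum_(p <- w) p.1 * SR p.2)).
  apply/eqP; rewrite -addr_eq0 addrA -[X in _ == X]h; apply/eqP; congr (_ + _).
  by rewrite (linearFsum _ _ lini); apply: eq_bigr => p _; rewrite iM HOE_antipode.
by rewrite -mulrN -h mulrA -iM aK i1 mul1r.
Qed.

Let delta1 : delta 1 = 0.
Proof.
have := proj2 HOE_der 1 1; rewrite !mulr1 sigma1 mul1r => h.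
by apply: (addrI (delta 1)); rewrite addr0 -h.
Qed.

(** Two values of [beta], the constant coefficient of [S(x)]: the left antipode axiom gives minus
    the left side, [antipode_var] gives minus the right side. *)
Lemma antipode_w :
  \sum_(p <- w) SR p.1 * p.2 = SR a * \sum_(p <- w) p.1 * SR p.2.
Proof.
have := congr1 (c 0) antipode_var; have := antipode_coef 0.
rewrite sum_antipode_v (linearF0 lini) !mul0r !mulr0 !addr0 STx eTx scale0r b1 i1.
rewrite !mulr1 (linearFN _ lin0) !(linearFD lin0, cM) !(ci, cx) mulr0 add0r mulr0 !add0r.
by move=> h h'; apply: (addrI beta); rewrite {}h {1}h' addNr.
Qed.

(** Two computations of [Delta(x r)]: directly as a product, and after rewriting [x r] as
    [sigma(r) x + delta(r)]. The next three lemmas take its coefficients at [x (x) 1], [1 (x) x] and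
    [1 (x) 1]. *)
Let commX r (Z : lmodType F) (f : T -> T -> Z) : bilinear_map f ->
  \sum_(q <- DR r) f (i a * i q.1) (x * i q.2)
  + \sum_(q <- DR r) f (x * i q.1) (i q.2)
  + \sum_(p <- w) \sum_(q <- DR r) f (i p.1 * i q.1) (i p.2 * i q.2) =
  \sum_(q <- DR (sigma r)) \sum_(y <- DT x) f (i q.1 * y.1) (i q.2 * y.2)
  + \sum_(q <- DR (delta r)) f (i q.1) (i q.2).
Proof.
move=> hf.
transitivity (\sum_(p <- DT (x * i r)) f p.1 p.2).
  rewrite (sum_DM HOE_hopfT _ _ hf).
  rewrite (@HOE_sum_comulX _ (fun u u' => \sum_(q <- DT (i r))
    f (u * q.1) (u' * q.2))); last by lin.
  rewrite v0 big_nil addr0 b1 i1.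
  rewrite (@HOE_sum_comul _ _ (fun u u' => f (i a * u) (x * u'))); last by lin.
  rewrite (@HOE_sum_comul _ _ (fun u u' => f (x * u) (1 * u'))); last by lin.
  congr (_ + _ + _).
    by apply: eq_bigr => p _; rewrite mul1r.
  apply: eq_bigr => p _.
  by rewrite (@HOE_sum_comul _ _ (fun u u' => f (i p.1 * u) (i p.2 * u'))); last by lin.
have lg : linearF (fun t => \sum_(p <- DT t) f p.1 p.2) by lin.
rewrite (proj1 HOE_skew) (linearFD lg) (HOE_sum_comul _ hf); congr (_ + _).
rewrite (sum_DM HOE_hopfT _ _ hf).
by rewrite (@HOE_sum_comul _ _ (fun u u' => \sum_(y <- DT x) f (u * y.1) (u' * y.2))); last by lin.
Qed.

Lemma comul_sigma_l r (Z : lmodType F) (f : R -> R -> Z) : bilinear_map f ->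
  \sum_(q <- DR r) f (sigma q.1) q.2 = \sum_(q <- DR (sigma r)) f q.1 q.2.
Proof.
move=> hf; have := @commX r _ (fun u u' => f (c 1 u) (c 0 u')).
rewrite [X in X + _ + _]big1 => [|q _]; last by rewrite cM !ci mulr0 bil0l.
rewrite [X in _ + _ + X]big1 => [|q _]; last first.
  by rewrite big1 // => y _; rewrite cM !ci mulr0 bil0l.
rewrite [X in _ = _ + X]big1 => [|q _]; last by rewrite !ci bil0l.
rewrite !addr0 add0r.
under eq_bigr => q _ do rewrite cX !ci (linearF0 lin_delta) addr0.
move=> ->; last by lin.
apply: eq_bigr => q _; under eq_bigr => y _ do rewrite !cM.
by rewrite (@comulX_coef10 _ (fun u u' => f (q.1 * u) (q.2 * u'))) ?b1 ?mulr1 //; lin.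
Qed.

Lemma comul_sigma_r r (Z : lmodType F) (f : R -> R -> Z) : bilinear_map f ->
  \sum_(q <- DR r) f (a * q.1) (sigma q.2) = \sum_(q <- DR (sigma r)) f (q.1 * a) q.2.
Proof.
move=> hf; have := @commX r _ (fun u u' => f (c 0 u) (c 1 u')).
rewrite [X in _ + X + _]big1 => [|q _]; last by rewrite ci bil0r.
rewrite [X in _ + _ + X]big1 => [|q _]; last first.
  by rewrite big1 // => y _; rewrite !cM !ci mulr0 bil0r.
rewrite [X in _ = _ + X]big1 => [|q _]; last by rewrite !ci bil0r.
rewrite !addr0.
under eq_bigr => q _ do rewrite cX cM !ci (linearF0 lin_delta) addr0.
move=> ->; last by lin.
apply: eq_bigr => q _; under eq_bigr => y _ do rewrite !cM.
by rewrite (@comulX_coef01 _ (fun u u' => f (q.1 * u) (q.2 * u'))) ?mulr1 //; lin.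
Qed.

Lemma comul_delta r (Z : lmodType F) (f : R -> R -> Z) : bilinear_map f ->
  \sum_(q <- DR r) f (a * q.1) (delta q.2) + \sum_(q <- DR r) f (delta q.1) q.2
  + \sum_(p <- w) \sum_(q <- DR r) f (p.1 * q.1) (p.2 * q.2) =
  \sum_(q <- DR (sigma r)) \sum_(p <- w) f (q.1 * p.1) (q.2 * p.2)
  + \sum_(q <- DR (delta r)) f q.1 q.2.
Proof.
move=> hf; have := @commX r _ (fun u u' => f (c 0 u) (c 0 u')).
under eq_bigr => q _ do rewrite cX cM !ci add0r.
under [X in _ + X + _ = _]eq_bigr => q _ do rewrite cX !ci add0r.
under [X in _ + X = _]eq_bigr => p _ do
  under eq_bigr => q _ do rewrite !cM !ci.
under [X in _ = X + _]eq_bigr => q _ do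
  under eq_bigr => y _ do rewrite !cM.
under [X in _ = _ + X]eq_bigr => q _ do rewrite !ci.
move=> ->; last by lin.
congr (_ + _); apply: eq_bigr => q _.
by rewrite (@comulX_coef00 _ (fun u u' => f (q.1 * u) (q.2 * u'))) //; lin.
Qed.

Let counit_w1 : \sum_(p <- w) eR p.1 *: p.2 = 0.
Proof.
have := congr1 (c 0) (counitl HOE_hopfT x).
rewrite (@HOE_sum_comulX _ (fun u u' => eT u *: u')); last by lin.
rewrite v0 big_nil eTx scale0r !addr0 cx (linearFD lin0) (linearFZ _ _ lin0) cx.
rewrite scaler0 add0r (linearFsum _ _ lin0) => h; rewrite -[RHS]h.
by apply: eq_bigr => p _; rewrite (linearFZ _ _ lin0) ci HOE_counit.
Qed.

Let counit_w2 : \sum_(p <- w) eR p.2 *: p.1 = 0.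
Proof.
have := congr1 (c 0) (counitr HOE_hopfT x).
rewrite (@HOE_sum_comulX _ (fun u u' => eT u' *: u)); last by lin.
rewrite v0 big_nil eTx scale0r !addr0 add0r cx (linearFD lin0) (linearFZ _ _ lin0) cx.
rewrite scaler0 add0r (linearFsum _ _ lin0) => h; rewrite -[RHS]h.
by apply: eq_bigr => p _; rewrite (linearFZ _ _ lin0) ci HOE_counit.
Qed.

Lemma conditions_hold : conds_def DR eR SR a (SR a) w sigma delta.
Proof.
(* The character is the counit composed with [sigma]. Applying the counit to the first factor in
   [comul_sigma_l] and to the second in [comul_sigma_r] gives the two formulas for [sigma]. *)
have [chiD chiM chi1] : [/\ linformF (fun r => eR (sigma r)),
    forall r s, eR (sigma (r * s)) = eR (sigma r) * eR (sigma s) &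
    eR (sigma 1) = 1].
  split=> [|r s|]; first by lin.
    by rewrite sigmaM (counitM HOE_hopfR).
  by rewrite sigma1 (counit1 HOE_hopfR).
split.
  exists (fun r => eR (sigma r)); split=> // r; split.
    by rewrite (@comul_sigma_l r _ (fun u u' => eR u *: u')) ?(counitl HOE_hopfR) //; lin.
  rewrite (@comul_sigma_r r _ (fun u u' => eR u' *: (u * SR a))); last by lin.
  under eq_bigr => q _ do rewrite -mulrA Ka mulr1.
  by rewrite (counitr HOE_hopfR).
split.
  move=> r Z f hf; rewrite !big_cat /= !(sum_tneg _ hf) !big_map !sum_tmul /=.
  have := comul_delta r hf.
  move: (\sum_(q <- DR (delta r)) _) => X0.
  move: (\sum_(p <- w) _) (\sum_(q <- DR (sigma r)) _) => X1 X2.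
  move: (\sum_(q <- DR r) _) (\sum_(q <- DR r) _) => X3 X4 h.
  have -> : X0 = X4 + X3 + X1 - X2 by rewrite h addrC addKr.
  by rewrite (AC (4*2) (3*4*(1*6)*(2*5))) /= !subrr !addr0.
split.
  (* Project both factors to the augmentation ideal by [r - eps(r) 1]. The class of [w] is unchanged
     because both of its partial counits vanish. *)
  exists [seq (p.1 - eR p.1 *: 1, p.2 - eR p.2 *: 1) | p <- w]; split; last first.
    rewrite all_map; apply/allP => p _ /=.
    rewrite !(linformFD lineR) !(linformFN _ lineR) !(linformFZ _ _ lineR).
    by rewrite (counit1 HOE_hopfR) !mulr1 !subrr eqxx.
  move=> Z f hf; rewrite big_map /=.
  have l1 u : linearF (f u) by lin.
  have l2 u : linearF (fun v => f v u) by lin.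
  have fB p : f (p.1 - eR p.1 *: 1) (p.2 - eR p.2 *: 1) =
    f p.1 p.2 - f (eR p.2 *: p.1) 1 - (f 1 (eR p.1 *: p.2)
      - f 1 (eR (eR p.1 *: p.2) *: 1)).
    rewrite (linearFD (l2 _)) (linearFN _ (l2 _)) !(linearFD (l1 _)) !(linearFN _ (l1 _)).
    rewrite !(linearFZ _ _ (l2 _)) !(linearFZ _ _ (l1 _)) (linformFZ _ _ lineR).
    by rewrite scalerA.
  under [RHS]eq_bigr => p _ do rewrite fB.
  rewrite !sumrB -(linearFsum _ _ (l2 1)) -!(linearFsum _ _ (l1 1)) -scaler_suml.
  rewrite -(linformFsum _ _ lineR) counit_w1 counit_w2 (linformF0 lineR) scale0r.
  by rewrite (linearF0 (l2 1)) !(linearF0 (l1 1)) !subr0.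
split; first exact: antipode_w.
move=> Z f hf; rewrite !big_cat /= !big_map !big_allpairs_dep /=.
(* The constant coefficient in all three factors removes the terms containing [x]. *)
have := @coassocX _ (fun u1 u2 u3 => f (c 0 u1) (c 0 u2) (c 0 u3)).
have f0 u u' : f 0 u u' = 0 by apply: (linearF0 (g := fun t => f t u u')); lin.
have f0' u u' : f u u' 0 = 0 by apply: (linearF0 (g := f u u')); lin.
rewrite v0 !big_nil !addr0.
rewrite [X in X + _ + _ = _]big1 => [|q _]; last by rewrite cx f0'.
rewrite [X in _ = _ + X + _]big1 => [|q _]; last by rewrite cx f0.
rewrite addr0 add0r !ci b1.
rewrite (@comulX_coef00 _ (fun u u' => f u u' 1)); last by lin.
rewrite (@comulX_coef00 _ (fun u u' => f a u u')); last by lin.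
under [X in _ + X = _]eq_bigr => p _ do
  under eq_bigr => q _ do rewrite !ci.
under [X in _ = _ + X]eq_bigr => p _ do
  under eq_bigr => q _ do rewrite !ci.
by apply; lin.
Qed.

End Normalized.

End AntipodeCondition.
End HopfOre.

(** * The algebra of tensors *)

Section TensorAlgebra.
Variables (F : fieldType) (A : algType F).

(** A comultiplication built from the universal property needs a ring as target, so the tensor
    product is realized as a quotient of formal sums; classical logic makes [teq2] boolean. *)
Definition tensor_rel (s t : seq (A * A)) : bool := `[< teq2 s t >].

Lemma tensor_rel_equiv : equiv_class_of tensor_rel.
Proof.
split=> [s|s t|t s u].
- exact/asboolP.
- by apply/asboolP/asboolP; apply: teq2_sym.
- by move=> /asboolP st /asboolP tu; apply/asboolP; apply: teq2_trans tu.
Qed.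

Canonical tensor_equiv := EquivRelPack tensor_rel_equiv.
Definition tensor := {eq_quot tensor_equiv}%qT.
HB.instance Definition _ := Choice.on tensor.

Definition tensor_of (s : seq (A * A)) : tensor := (\pi_tensor s)%qT.
Definition tensor_repr (u : tensor) : seq (A * A) := repr u.

Lemma tensorP s t : tensor_of s = tensor_of t <-> teq2 s t.
Proof.
split=> [/eqP|st]; first by rewrite /tensor_of eqmodE => /asboolP.
by apply/eqP; rewrite /tensor_of eqmodE; apply/asboolP.
Qed.

Lemma tensor_reprK u : tensor_of (tensor_repr u) = u.
Proof. exact: reprK. Qed.

Lemma teq2_repr s : teq2 (tensor_repr (tensor_of s)) s.
Proof. by apply/tensorP; rewrite tensor_reprK. Qed.

Definition tensor_add u v := tensor_of (tensor_repr u ++ tensor_repr v).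
Definition tensor_opp u := tensor_of (tneg (tensor_repr u)).
Definition tensor_mul u v := tensor_of (tmul (tensor_repr u) (tensor_repr v)).

Let addE s t : tensor_add (tensor_of s) (tensor_of t) = tensor_of (s ++ t).
Proof. by apply/tensorP/teq2_cat; apply: teq2_repr. Qed.
Let oppE s : tensor_opp (tensor_of s) = tensor_of (tneg s).
Proof. by apply/tensorP/teq2_neg; apply: teq2_repr. Qed.
Let mulE s t : tensor_mul (tensor_of s) (tensor_of t) = tensor_of (tmul s t).
Proof. by apply/tensorP/teq2_mul; apply: teq2_repr. Qed.

Let addA : associative tensor_add.
Proof.
move=> u v w; rewrite -[u]tensor_reprK -[v]tensor_reprK -[w]tensor_reprK.
by rewrite !addE catA.
Qed.
Let addC : commutative tensor_add.
Proof.
move=> u v; rewrite -[u]tensor_reprK -[v]tensor_reprK !addE.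
by apply/tensorP => Z f _; rewrite !big_cat /= addrC.
Qed.
Let add0 : left_id (tensor_of [::]) tensor_add.
Proof. by move=> u; rewrite -[u]tensor_reprK addE. Qed.
Let addN : left_inverse (tensor_of [::]) tensor_opp tensor_add.
Proof.
move=> u; rewrite -[u]tensor_reprK oppE addE; apply/tensorP => Z f hf.
by rewrite big_cat /= sum_tneg // addNr big_nil.
Qed.

HB.instance Definition _ := GRing.isZmodule.Build tensor addA addC add0 addN.

Let mulA : associative tensor_mul.
Proof.
move=> u v w; rewrite -[u]tensor_reprK -[v]tensor_reprK -[w]tensor_reprK !mulE.
apply/tensorP => Z f hf; rewrite !sum_tmul.
rewrite [RHS](sum_tmul (fun y z => \sum_(q <- _) f (y * q.1) (z * q.2))).
apply: eq_bigr => p _; rewrite (sum_tmul (fun y z => f (p.1 * y) (p.2 * z))).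
by apply: eq_bigr => q _; apply: eq_bigr => r _; rewrite !mulrA.
Qed.
Let mul1l : left_id (tensor_of [:: (1, 1)]) tensor_mul.
Proof.
move=> u; rewrite -[u]tensor_reprK mulE; apply/tensorP => Z f hf.
by rewrite sum_tmul big_seq1; apply: eq_bigr => p _; rewrite !mul1r.
Qed.
Let mul1r' : right_id (tensor_of [:: (1, 1)]) tensor_mul.
Proof.
move=> u; rewrite -[u]tensor_reprK mulE; apply/tensorP => Z f hf.
by rewrite sum_tmul; apply: eq_bigr => p _; rewrite big_seq1 !mulr1.
Qed.
Let mulDl : left_distributive tensor_mul +%R.
Proof.
move=> u v w; rewrite -[u]tensor_reprK -[v]tensor_reprK -[w]tensor_reprK.
rewrite [_ + _ in LHS]addE !mulE [RHS]addE; apply/tensorP => Z f hf.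
by rewrite big_cat /= !sum_tmul big_cat.
Qed.
Let mulDr : right_distributive tensor_mul +%R.
Proof.
move=> u v w; rewrite -[u]tensor_reprK -[v]tensor_reprK -[w]tensor_reprK.
rewrite [_ + _ in LHS]addE !mulE [RHS]addE; apply/tensorP => Z f hf.
rewrite big_cat /= !sum_tmul -big_split /=.
by apply: eq_bigr => p _; rewrite big_cat.
Qed.

HB.instance Definition _ :=
  GRing.Zmodule_isPzRing.Build tensor mulA mul1l mul1r' mulDl mulDr.

Lemma tensor_ofD s t : tensor_of (s ++ t) = tensor_of s + tensor_of t.
Proof. by rewrite -addE. Qed.
Lemma tensor_ofM s t : tensor_of (tmul s t) = tensor_of s * tensor_of t.
Proof. by rewrite -mulE. Qed.
Lemma tensor_of1 : tensor_of [:: (1, 1)] = 1.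
Proof. by []. Qed.
(** Scaling becomes multiplication by an element, so a multiplicative map into [tensor A] is linear
    as soon as it is additive and right on scalars. *)
Lemma tensor_of_scale l s :
  tensor_of (tscale l s) = tensor_of [:: (l *: 1, 1)] * tensor_of s.
Proof.
rewrite -tensor_ofM; apply/tensorP => Z f hf.
rewrite sum_tscale // sum_tmul big_seq1 scaler_sumr; apply: eq_bigr => p _ /=.
rewrite mul1r -scalerAl mul1r.
by rewrite (linearFZ (g := fun u => f u p.2)) //; lin.
Qed.

End TensorAlgebra.

(** * Existence of the skew polynomial algebra *)

Record ore_data (F : fieldType) (R : algType F) := OreData {
  ore_sigma : R -> R;
  ore_delta : R -> R;
  ore_linear : linearF ore_sigma;
  ore_morphM : forall r s, ore_sigma (r * s) = ore_sigma r * ore_sigma s;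
  ore_morph1 : ore_sigma 1 = 1;
  ore_der : sigma_der ore_sigma ore_delta }.

(** A copy of the free left module [{poly R}], indexed by [d] so that the twisted product can be
    attached to it. *)
Definition ore (F : fieldType) (R : algType F) (d : ore_data R) : Type := {poly R}.

Section OreExtension.
Variables (F : fieldType) (R : algType F) (d : ore_data R).
Local Notation sigma := (ore_sigma d).
Local Notation delta := (ore_delta d).
Implicit Types (p q : {poly R}) (r : R).

Let lins : linearF sigma := @ore_linear _ _ d.
Let sigma1 : sigma 1 = 1 := @ore_morph1 _ _ d.
Let lind : linearF delta := proj1 (@ore_der _ _ d).
Let deltaM r s : delta (r * s) = delta r * s + sigma r * delta s :=
  proj2 (@ore_der _ _ d) r s.
Let delta1 : delta 1 = 0.
Proof.
have := deltaM 1 1; rewrite !mulr1 sigma1 mul1r => h.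
by apply: (addrI (delta 1)); rewrite addr0 -h.
Qed.

(* Left multiplication by [x] on [R[x; sigma, delta]], with coefficients on the left. *)
Definition oreX p : {poly R} := map_poly sigma p * 'X + map_poly delta p.

Lemma coef_oreX p k : (oreX p)`_k = (if k is k'.+1 then sigma p`_k' else 0) + delta p`_k.
Proof.
rewrite /oreX coefD coefMX !coef_map_id0 ?(linearF0 lins) ?(linearF0 lind) //.
by case: k.
Qed.

Lemma oreXD : {morph oreX : p q / p + q}.
Proof.
move=> p q; apply/polyP => k; rewrite [RHS]coefD !coef_oreX !coefD (linearFD lind).
by case: k => [|k]; rewrite ?add0r // coefD (linearFD lins) addrACA.
Qed.

Lemma oreXZ r p : oreX (r *: p) = sigma r *: oreX p + delta r *: p.
Proof.
apply/polyP => k; rewrite [RHS]coefD !coefZ !coef_oreX !coefZ deltaM.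
case: k => [|k]; first by rewrite !add0r addrC.
by rewrite coefZ ore_morphM mulrDr -addrA; congr (_ + _); rewrite addrC.
Qed.

Lemma oreXpower n : oreX 'X^n = 'X^(n.+1).
Proof.
have d0 k : delta ('X^n : {poly R})`_k = 0.
  by rewrite coefXn; case: eqP => _; rewrite ?delta1 ?(linearF0 lind).
apply/polyP => k; rewrite coef_oreX d0 addr0 coefXn; case: k => [//|k].
by rewrite coefXn eqSS; case: eqP => _; rewrite ?sigma1 ?(linearF0 lins).
Qed.

(** Scalars of [F] are fixed by [sigma] and killed by [delta], hence commute with the variable. *)
Lemma oreX_scalar (l : F) p : oreX (l%:A *: p) = l%:A *: oreX p.
Proof.
by rewrite oreXZ (linearFZ _ _ lins) sigma1 (linearFZ _ _ lind) delta1 scaler0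
  scale0r addr0.
Qed.

Lemma size_oreX p N : (size p <= N)%N -> (size (oreX p) <= N.+1)%N.
Proof.
move=> pN; apply/leq_sizeP => k Nk; rewrite coef_oreX.
rewrite (nth_default 0 (leq_trans pN (ltnW Nk))) (linearF0 lind) addr0.
by case: k Nk => [//|k] Nk; rewrite nth_default ?(linearF0 lins) ?(leq_trans pN).
Qed.

Lemma iter_oreXD n : {morph iter n oreX : p q / p + q}.
Proof. by move=> p q; elim: n => [//|n /= ->]; rewrite oreXD. Qed.

(** Here [p] acts on [q] as the operator obtained by substituting [oreX] for the variable. *)
Definition ore_mul p q : {poly R} := \sum_(k < size p) p`_k *: iter k oreX q.

Let widen_sum (V : zmodType) p N (g : nat -> R -> V) : (forall k, g k 0 = 0) ->
  (size p <= N)%N -> \sum_(k < size p) g k p`_k = \sum_(k < N) g k p`_k.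
Proof.
move=> g0 pN; rewrite (big_ord_widen N (fun k => g k p`_k)) // big_mkcond.
apply: eq_bigr => k _; case: ltnP => // sk.
by rewrite nth_default // g0.
Qed.

Lemma ore_mulE p q N : (size p <= N)%N ->
  ore_mul p q = \sum_(k < N) p`_k *: iter k oreX q.
Proof.
move=> pN; apply: (widen_sum (g := fun k r => r *: iter k oreX q)) => // k.
by rewrite scale0r.
Qed.

Lemma ore_mulDl : left_distributive ore_mul +%R.
Proof.
move=> p p' q; pose N := maxn (size p) (size p').
rewrite (@ore_mulE p q N) ?leq_maxl // (@ore_mulE p' q N) ?leq_maxr //.
rewrite (@ore_mulE (p + p') q N) ?size_polyD // -big_split.
by apply: eq_bigr => k _; rewrite /= coefD scalerDl.
Qed.

Lemma ore_mulDr : right_distributive ore_mul +%R.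
Proof.
move=> p q q'; rewrite -big_split; apply: eq_bigr => k _ /=.
by rewrite iter_oreXD scalerDr.
Qed.

Lemma ore_mul0 q : ore_mul 0 q = 0.
Proof. by rewrite /ore_mul size_poly0 big_ord0. Qed.

Lemma ore_mulZ r p q : ore_mul (r *: p) q = r *: ore_mul p q.
Proof.
rewrite (@ore_mulE _ _ (size p)) ?size_scale_leq // scaler_sumr.
by apply: eq_bigr => k _; rewrite coefZ scalerA.
Qed.

(** Associativity when the left factor is the variable; [ore_mulA] follows by additivity and
    iteration. *)
Lemma ore_mulX p q : ore_mul (oreX p) q = oreX (ore_mul p q).
Proof.
rewrite (@ore_mulE _ _ (size p).+1) ?size_oreX //.
under eq_bigr => k _ do rewrite coef_oreX scalerDl.
rewrite big_split /= big_ord_recl scale0r add0r.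
rewrite [X in _ + X]big_ord_recr /= nth_default // (linearF0 lind) scale0r addr0.
rewrite -big_split /= /ore_mul.
rewrite (big_morph oreX oreXD (_ : oreX 0 = 0)).
  by apply: eq_bigr => k _; rewrite oreXZ.
by apply: (addrI (oreX 0)); rewrite -oreXD !addr0.
Qed.

Lemma ore_mulA : associative ore_mul.
Proof.
move=> p q q'; rewrite {1 4}/ore_mul.
rewrite (big_morph (ore_mul^~ q') (fun u v => ore_mulDl u v q') (ore_mul0 q')).
apply: eq_bigr => k _; rewrite ore_mulZ; congr (_ *: _).
by elim: (k : nat) => [//|n /= ->]; rewrite ore_mulX.
Qed.

Lemma ore_mul1l : left_id 1 ore_mul.
Proof. by move=> p; rewrite /ore_mul size_poly1 big_ord1 coef1 scale1r. Qed.

Lemma iter_oreX1 n : iter n oreX 1 = 'X^n.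
Proof. by elim: n => [|n /= ->]; rewrite ?expr0 ?oreXpower. Qed.

Lemma ore_mul1r : right_id 1 ore_mul.
Proof.
move=> p; rewrite -[RHS]coefK poly_def; apply: eq_bigr => k _.
by rewrite iter_oreX1.
Qed.

HB.instance Definition _ := GRing.Zmodule.copy (ore d) {poly R}.

HB.instance Definition _ := GRing.Zmodule_isNzRing.Build (ore d)
  ore_mulA ore_mul1l ore_mul1r ore_mulDl ore_mulDr (oner_neq0 {poly R}).

(** The field acts through [l%:A] and the scaling of [{poly R}] by [R]. *)
Let scaleA (l m : F) p : l%:A *: (m%:A *: p) = (l * m)%:A *: p :> {poly R}.
Proof. by rewrite scalerA -scalerAl mul1r scalerA. Qed.
Let scale1 p : (1 : F)%:A *: p = p :> {poly R}.
Proof. by rewrite !scale1r. Qed.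
Let scaleDr (l : F) p q : l%:A *: (p + q) = l%:A *: p + l%:A *: q :> {poly R}.
Proof. by rewrite scalerDr. Qed.
Let scaleDl p (l m : F) : (l + m)%:A *: p = l%:A *: p + m%:A *: p :> {poly R}.
Proof. by rewrite !scalerDl. Qed.

HB.instance Definition _ :=
  GRing.Zmodule_isLmodule.Build F (ore d) scaleA scale1 scaleDr scaleDl.

Let scaleAl (l : F) (u v : ore d) : l *: (u * v) = (l *: u) * v.
Proof. by symmetry; apply: ore_mulZ. Qed.
HB.instance Definition _ := GRing.Lmodule_isLalgebra.Build F (ore d) scaleAl.

Let scaleAr (l : F) (u v : ore d) : l *: (u * v) = u * (l *: v).
Proof.
suff: l%:A *: ore_mul u v = ore_mul u (l%:A *: v) by [].
rewrite /ore_mul scaler_sumr; apply: eq_bigr => k _.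
have -> : iter k oreX (l%:A *: v : {poly R}) = l%:A *: iter k oreX v.
  by elim: (k : nat) => [//|n /= ->]; rewrite oreX_scalar.
by rewrite !scalerA -scalerAl -scalerAr mul1r mulr1.
Qed.
HB.instance Definition _ := GRing.Lalgebra_isAlgebra.Build F (ore d) scaleAr.

Definition ore_const r : ore d := r%:P.
Definition ore_var : ore d := ('X : {poly R}).

Lemma ore_constM r (u : ore d) : ore_const r * u = r *: (u : {poly R}).
Proof.
suff: ore_mul r%:P u = r *: (u : {poly R}) by [].
by rewrite (@ore_mulE _ _ 1) ?size_polyC_leq1 // big_ord1 coefC.
Qed.

Lemma ore_varM (u : ore d) : ore_var * u = oreX u.
Proof.
suff: ore_mul 'X u = oreX u by [].
by rewrite /ore_mul size_polyX big_ord_recl big_ord1 !coefX /= scale0r add0r scale1r.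
Qed.

Lemma ore_varX n : ore_var ^+ n = 'X^n.
Proof.
elim: n => [//|n IH]; rewrite [LHS]exprS IH ore_varM.
exact: oreXpower.
Qed.

Lemma ore_expand (u : ore d) :
  u = \sum_(k < size (u : {poly R})) ore_const (u : {poly R})`_k * ore_var ^+ k.
Proof.
rewrite -[LHS](coefK (u : {poly R})) poly_def; apply: eq_bigr => k _.
by rewrite ore_constM ore_varX.
Qed.

Lemma ore_const_inj : injective ore_const. Proof. exact: polyC_inj. Qed.
Lemma ore_const_linear : linearF ore_const.
Proof.
move=> l r s; suff: (l *: r + s)%:P = l%:A *: r%:P + s%:P by [].
by rewrite polyCD -mul_polyC -polyCM -scalerAl mul1r.
Qed.
Lemma ore_const_morphM r s : ore_const (r * s) = ore_const r * ore_const s.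
Proof. by rewrite ore_constM /ore_const polyCM mul_polyC. Qed.
Lemma ore_const1 : ore_const 1 = 1. Proof. by []. Qed.

Lemma ore_skew : skew_poly ore_const ore_var sigma delta.
Proof.
split=> [r|].
  rewrite ore_varM ore_constM; apply/polyP => k.
  suff: (oreX r%:P)`_k = (sigma r *: 'X + (delta r)%:P)`_k by [].
  rewrite coef_oreX coefD coefZ coefX !coefC.
  case: k => [|[|k]] /=; rewrite ?coefC ?mulr0 ?mulr1 ?(linearF0 lind) //=.
  by rewrite (linearF0 lins).
split=> [u|s s0]; first by exists u; apply: ore_expand.
have s0' : \poly_(k < size s) s`_k = 0.
  rewrite -[RHS]s0 poly_def; apply: eq_bigr => k _.
  by rewrite ore_constM ore_varX.
apply/(all_nthP 0) => k ks; apply/eqP.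
by have := congr1 (fun p : {poly R} => p`_k) s0'; rewrite coef_poly ks coef0.
Qed.

(** * The universal property of the skew polynomial algebra *)

Section Universal.
Variables (B : pzRingType) (phi : R -> B) (X : B).
Hypothesis phiD : {morph phi : r s / r + s}.
Hypothesis phiM : {morph phi : r s / r * s}.
Hypothesis phi1 : phi 1 = 1.
Hypothesis phiX : forall r, X * phi r = phi (sigma r) * X + phi (delta r).

(** The target is any ring, to cover [tensor T], [F] and the opposite ring [T^c]. *)
Definition ore_lift (u : ore d) : B :=
  \sum_(k < size (u : {poly R})) phi (u : {poly R})`_k * X ^+ k.

Let phi0 : phi 0 = 0.
Proof. by apply: (addrI (phi 0)); rewrite -phiD !addr0. Qed.

Let liftE p N : (size p <= N)%N ->
  ore_lift p = \sum_(k < N) phi p`_k * X ^+ k.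
Proof.
move=> pN; apply: (widen_sum (g := fun k r => phi r * X ^+ k)) => // k.
by rewrite phi0 mul0r.
Qed.

Lemma ore_liftD : {morph ore_lift : u v / u + v}.
Proof.
move=> p q; pose N := maxn (size (p : {poly R})) (size (q : {poly R})).
rewrite (@liftE p N) ?leq_maxl // (@liftE q N) ?leq_maxr //.
rewrite (@liftE (p + q) N) ?size_polyD // -big_split.
by apply: eq_bigr => k _; rewrite /= coefD phiD mulrDl.
Qed.

Lemma ore_lift_const r : ore_lift (ore_const r) = phi r.
Proof. by rewrite (@liftE _ 1) ?size_polyC_leq1 // big_ord1 coefC mulr1. Qed.

Lemma ore_lift_var : ore_lift ore_var = X.
Proof.
rewrite /ore_lift size_polyX big_ord_recl big_ord1 !coefX /= phi0 mul0r add0r.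
by rewrite phi1 mul1r.
Qed.

Let lift_constM r p : ore_lift (r *: p) = phi r * ore_lift p.
Proof.
rewrite (@liftE _ (size p)) ?size_scale_leq // mulr_sumr.
by apply: eq_bigr => k _; rewrite coefZ phiM mulrA.
Qed.

Let lift_varM p : ore_lift (oreX p) = X * ore_lift p.
Proof.
rewrite (@liftE _ (size p).+1) ?size_oreX //.
under eq_bigr => k _ do rewrite coef_oreX phiD mulrDl.
rewrite big_split /= big_ord_recl phi0 mul0r add0r.
rewrite [X in _ + X]big_ord_recr /= nth_default // (linearF0 lind) phi0 mul0r addr0.
rewrite -big_split /= mulr_sumr; apply: eq_bigr => k _.
by rewrite mulrA phiX mulrDl -mulrA -exprS.
Qed.

(** Additivity and [lift_constM] reduce to left multiplication by powers of the variable, where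
    [lift_varM] uses the commutation relation [phiX]. *)
Lemma ore_liftM : {morph ore_lift : u v / u * v}.
Proof.
move=> p q; rewrite [in RHS]/ore_lift mulr_suml.
have lift0 : ore_lift 0 = 0 by rewrite (@liftE _ 0) ?size_poly0 // big_ord0.
rewrite [p * q]/(ore_mul p q) (big_morph ore_lift ore_liftD lift0).
apply: eq_bigr => k _; rewrite lift_constM -mulrA; congr (_ * _).
elim: (k : nat) => [|n IH] /=; first by rewrite mul1r.
by rewrite lift_varM IH mulrA -exprS.
Qed.

End Universal.
End OreExtension.

(** * The Hopf structure on a skew polynomial algebra *)

(** Constants and the variable generate the ring, so each Hopf axiom is checked on them and shown to
    be stable under sums and products. *)
Lemma ore_ind (F : fieldType) (R : algType F) (d : ore_data R) (P : ore d -> Prop) :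
  (forall r, P (ore_const d r)) -> P (ore_var d) ->
  (forall u v, P u -> P v -> P (u + v)) -> (forall u v, P u -> P v -> P (u * v)) ->
  forall u, P u.
Proof.
move=> Pc Px PD PM u.
have PX n : P (ore_var d ^+ n).
  elim: n => [|n IH]; first by rewrite expr0 -(ore_const1 d).
  by rewrite exprS; apply: PM.
rewrite (ore_expand u); apply: (big_ind P) => // [|k _]; last exact: PM.
have -> : 0 = ore_const d 0 by rewrite (linearF0 (ore_const_linear d)).
exact: Pc.
Qed.

Section Converse.
Variables (F : fieldType) (R : algType F).
Variables (DR : R -> seq (R * R)) (eR : R -> F) (SR : R -> R).
Hypothesis hopfR : is_hopf DR eR SR.
Variables (a ainv : R) (w : seq (R * R)) (sigma delta : R -> R) (chi : R -> F).
Hypothesis gla : grouplike DR a.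
Hypothesis aK : a * ainv = 1.
Hypothesis Ka : ainv * a = 1.
Hypothesis autos : alg_auto sigma.
Hypothesis der : sigma_der sigma delta.
Hypothesis lin_chi : linformF chi.
Hypothesis chiM : forall r s, chi (r * s) = chi r * chi s.
Hypothesis chi1 : chi 1 = 1.
Hypothesis sigma_l : forall r, sigma r = \sum_(p <- DR r) chi p.1 *: p.2.
Hypothesis sigma_r :
  forall r, sigma r = \sum_(p <- DR r) chi p.2 *: (a * p.1 * ainv).
Hypothesis comul_der : forall r,
  teq2 (DR (delta r) ++ tneg [seq (delta p.1, p.2) | p <- DR r]
                     ++ tneg [seq (a * p.1, delta p.2) | p <- DR r])
       (tmul w (DR r) ++ tneg (tmul (DR (sigma r)) w)).
Hypothesis w_augm : exists w' : seq (R * R), teq2 w w' /\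
  all (fun p => (eR p.1 == 0) && (eR p.2 == 0)) w'.
Hypothesis w_antipode :
  \sum_(p <- w) SR p.1 * p.2 = ainv * \sum_(p <- w) p.1 * SR p.2.
Hypothesis w_coassoc :
  teq3 ([seq (p.1, p.2, 1) | p <- w] ++ [seq (q.1, q.2, p.2) | p <- w, q <- DR p.1])
       ([seq (a, p.1, p.2) | p <- w] ++ [seq (p.1, q.1, q.2) | p <- w, q <- DR p.2]).

Let linDR := hopf_linD hopfR.
Let lineR := hopf_lin_counit hopfR.
Let linSR := hopf_lin_antipode hopfR.
Let lins : linearF sigma := proj1 autos.
Let sigmaM r s : sigma (r * s) = sigma r * sigma s := proj1 (proj2 autos) r s.
Let sigma1 : sigma 1 = 1 := proj1 (proj2 (proj2 autos)).
Let sigma_bij : bijective sigma := proj2 (proj2 (proj2 autos)).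
Let lind : linearF delta := proj1 der.
Let deltaM r s : delta (r * s) = delta r * s + sigma r * delta s := proj2 der r s.
Let delta1 : delta 1 = 0.
Proof.
have := deltaM 1 1; rewrite !mulr1 sigma1 mul1r => h.
by apply: (addrI (delta 1)); rewrite addr0 -h.
Qed.
Let Da : teq2 (DR a) [:: (a, a)] := proj1 gla.
Let Dainv : teq2 (DR ainv) [:: (ainv, ainv)] := grouplikeV hopfR Da aK Ka.
Let ea : eR a = 1 := grouplike_counit hopfR gla.
Let Sa : SR a = ainv.
Proof.
have [Saa _] := grouplike_antipode hopfR gla.
by rewrite -[SR a]mulr1 -aK mulrA Saa mul1r.
Qed.

(** * Identities in [R] derived from conditions (d), (e) and (f) *)

Lemma winding_comul_l r (Z : lmodType F) (f : R -> R -> Z) : bilinear_map f ->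
  \sum_(q <- DR (sigma r)) f q.1 q.2 = \sum_(q <- DR r) f (sigma q.1) q.2.
Proof.
move=> hf; have lg : linearF (fun u => \sum_(q <- DR u) f q.1 q.2) by lin.
rewrite sigma_l (linearFsum _ _ lg).
under eq_bigr => p _ do rewrite (linearFZ _ _ lg) scaler_sumr.
rewrite -(@coassoc _ _ _ _ _ hopfR _ (fun u1 u2 u3 => chi u1 *: f u2 u3)); last by lin.
apply: eq_bigr => p _; have l1 : linearF (fun u => f u p.2) by lin.
by rewrite sigma_l (linearFsum _ _ l1); apply: eq_bigr => q _; rewrite (linearFZ _ _ l1).
Qed.

(** Coassociativity applied to the second formula for [sigma]. As [a] and [ainv] are group-like,
    conjugation by [a] acts on both tensor factors, and the extra [a] cancels [ainv] in the
    first. *)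
Lemma winding_comul_r r (Z : lmodType F) (f : R -> R -> Z) : bilinear_map f ->
  \sum_(q <- DR (sigma r)) f (q.1 * a) q.2 = \sum_(q <- DR r) f (a * q.1) (sigma q.2).
Proof.
move=> hf; have lg : linearF (fun u => \sum_(q <- DR u) f (q.1 * a) q.2) by lin.
rewrite sigma_r (linearFsum _ _ lg).
have conj u : \sum_(q <- DR (a * u * ainv)) f (q.1 * a) q.2 =
    \sum_(q <- DR u) f (a * q.1) (a * q.2 * ainv).
  rewrite (@sum_DM _ _ _ _ _ hopfR _ (fun u v => f (u * a) v)); last by lin.
  rewrite exchange_big.
  rewrite (Dainv (f := fun u1 u2 => \sum_(q <- DR (a * u))
    f (q.1 * u1 * a) (q.2 * u2))); last by lin.
  rewrite big_seq1 /= (@sum_DM _ _ _ _ _ hopfR _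
    (fun u v => f (u * ainv * a) (v * ainv))); last by lin.
  rewrite (Da (f := fun u1 u2 => \sum_(q <- DR u)
    f (u1 * q.1 * ainv * a) (u2 * q.2 * ainv))); last by lin.
  by rewrite big_seq1; apply: eq_bigr => q _; rewrite -(mulrA _ ainv a) Ka mulr1.
under eq_bigr => p _ do rewrite (linearFZ _ _ lg) conj scaler_sumr.
rewrite (@coassoc _ _ _ _ _ hopfR _
  (fun u1 u2 u3 => chi u3 *: f (a * u1) (a * u2 * ainv))); last by lin.
apply: eq_bigr => p _; have l1 : linearF (f (a * p.1)) by lin.
by rewrite sigma_r (linearFsum _ _ l1); apply: eq_bigr => q _; rewrite (linearFZ _ _ l1).
Qed.

Let comul_delta_sum r (Z : lmodType F) (f : R -> R -> Z) : bilinear_map f ->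
  \sum_(q <- DR r) f (a * q.1) (delta q.2) + \sum_(q <- DR r) f (delta q.1) q.2
  + \sum_(p <- w) \sum_(q <- DR r) f (p.1 * q.1) (p.2 * q.2) =
  \sum_(q <- DR (sigma r)) \sum_(p <- w) f (q.1 * p.1) (q.2 * p.2)
  + \sum_(q <- DR (delta r)) f q.1 q.2.
Proof.
move=> hf; have := comul_der r hf.
rewrite !big_cat /= !(sum_tneg _ hf) !big_map !sum_tmul /=.
move: (\sum_(q <- DR (delta r)) _) (\sum_(q <- DR (sigma r)) _) => X0 X1.
move: (\sum_(p <- w) _) (\sum_(q <- DR r) f (a * _) _) => X2 X3.
move: (\sum_(q <- DR r) _) => X4 h.
have -> : X2 = X0 + (- X4 - X3) + X1 by rewrite h subrK.
by rewrite (AC (2*((1*2)*1)) ((6*3)*((1*5)*(2*4)))) /= !subrr !addr0.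
Qed.

Let w_zero (Z : lmodType F) (f : R -> R -> Z) : bilinear_map f ->
  (forall u v, eR u = 0 -> eR v = 0 -> f u v = 0) -> \sum_(p <- w) f p.1 p.2 = 0.
Proof.
move=> hf f0; have [w' [ww' /allP w'0]] := w_augm.
rewrite (ww' _ _ hf) big1_seq // => p /andP[_ /w'0 /andP[/eqP e1 /eqP e2]].
exact: f0.
Qed.

(** Apply the counit to both factors of (e): the [w] terms vanish and what remains is [eps(delta r)
    + eps(delta r) = eps(delta r)]. *)
Lemma counit_delta r : eR (delta r) = 0.
Proof.
have bil : bilinear_map (fun u v : R => eR u *: (eR v *: (1 : R))) by lin.
have := comul_delta_sum r bil.
rewrite [X in _ + X = _](w_zero (f := fun u v => \sum_(q <- DR r)
  eR (u * q.1) *: (eR (v * q.2) *: 1))); [|by lin|]; last first.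
  by move=> u v eu ev; rewrite big1 // => q _; rewrite (counitM hopfR) eu mul0r scale0r.
rewrite [X in _ = X + _]big1 => [|q _]; last first.
  apply: (w_zero (f := fun u v => eR (q.1 * u) *: (eR (q.2 * v) *: 1))); first by lin.
  by move=> u v eu ev; rewrite (counitM hopfR) eu mulr0 scale0r.
rewrite addr0 add0r.
have l1 : linearF (fun v : R => eR v *: (1 : R)) by lin.
have l2 : linearF (fun v : R => eR (delta v) *: (1 : R)) by lin.
rewrite (counitl_lin hopfR _ l1) addrC.
under eq_bigr => q _ do rewrite scalerA mulrC -scalerA.
rewrite (counitr_lin hopfR _ l2).
under eq_bigr => q _ do rewrite (counitM hopfR) ea mul1r.
rewrite (counitl_lin hopfR _ l2) => h.
have := congr1 eR (addrI _ (etrans h (esym (addr0 _)))).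
by rewrite (linformFZ _ _ lineR) (counit1 hopfR) mulr1 (linformF0 lineR).
Qed.

(* Since [sigma r * a = chi(r_2) a r_1], convolving with the inverse [chi \o S]
   of [chi] moves [a] to the right of [sigma]. *)
Let a_mul r : a * r = \sum_(p <- DR r) chi (SR p.2) *: (sigma p.1 * a).
Proof.
have sa u : sigma u * a = \sum_(q <- DR u) chi q.2 *: (a * q.1).
  rewrite sigma_r mulr_suml; apply: eq_bigr => q _.
  by rewrite -scalerAl -(mulrA _ ainv a) Ka mulr1.
under eq_bigr => p _ do rewrite sa scaler_sumr.
rewrite (@coassoc _ _ _ _ _ hopfR _
  (fun u1 u2 u3 => chi (SR u3) *: (chi u2 *: (a * u1)))); last by lin.
rewrite -[LHS](@counitr_lin _ _ _ _ _ hopfR _ ( *%R a)); last by lin.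
apply: eq_bigr => p _; under eq_bigr => q _ do rewrite scalerA mulrC -chiM.
rewrite -scaler_suml -(linformFsum _ _ lin_chi) (antipoder hopfR).
by rewrite (linformFZ _ _ lin_chi) chi1 mulr1.
Qed.

Let chi_antipode_sigma r : chi (SR (sigma r)) = eR r.
Proof.
rewrite sigma_l (linearFsum _ _ linSR) (linformFsum _ _ lin_chi).
transitivity (chi (\sum_(p <- DR r) p.1 * SR p.2)).
  rewrite (linformFsum _ _ lin_chi); apply: eq_bigr => p _.
  by rewrite (linearFZ _ _ linSR) (linformFZ _ _ lin_chi) chiM.
by rewrite (antipoder hopfR) (linformFZ _ _ lin_chi) chi1 mulr1.
Qed.

(** The map [r |-> a^-1 sigma(S(sigma r)) a] is a convolution inverse of the identity:
    [winding_comul_l] turns the sum into one over [DR (sigma r)], [a_mul] moves [a] to the right,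
    [S(u_1) u_2] collapses, and [chi(S(sigma r)) = eps(r)] is left. *)
Lemma antipode_sigma r : SR r * ainv = ainv * sigma (SR (sigma r)).
Proof.
suff: (fun r => ainv * sigma (SR (sigma r)) * a) =1 SR.
  by move=> <-; rewrite -mulrA aK mulr1.
apply: (conv_id_inj hopfR); try by lin.
move=> {}r; rewrite (antipodel hopfR).
rewrite -(@winding_comul_l r _ (fun u v => ainv * sigma (SR u) * a * v)); last by lin.
under eq_bigr => p _ do rewrite -mulrA a_mul mulr_sumr.
rewrite -(@coassoc _ _ _ _ _ hopfR _ (fun u1 u2 u3 =>
  ainv * sigma (SR u1) * (chi (SR u3) *: (sigma u2 * a)))); last by lin.
have inner u v : \sum_(q <- DR u) ainv * sigma (SR q.1) * (chi (SR v) *: (sigma q.2 * a))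
    = eR u *: (chi (SR v) *: 1).
  transitivity (chi (SR v) *: (ainv * sigma (\sum_(q <- DR u) SR q.1 * q.2) * a)).
    rewrite (linearFsum _ _ lins) mulr_sumr mulr_suml scaler_sumr.
    by apply: eq_bigr => q _; rewrite -scalerAr sigmaM !mulrA.
  rewrite (antipodel hopfR) (linearFZ _ _ lins) sigma1 -scalerAr mulr1 -scalerAl Ka.
  by rewrite !scalerA mulrC.
under eq_bigr => p _ do rewrite inner.
rewrite (@counitl_lin _ _ _ _ _ hopfR _ (fun v => chi (SR v) *: 1)); last by lin.
by rewrite chi_antipode_sigma.
Qed.

Local Notation U := (\sum_(p <- w) SR p.1 * p.2).

(** Apply [S (x) id] and multiply in (e), then rewrite every sum as a convolution product with the
    identity. *)
Lemma antipode_delta r :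
  SR (delta r) = ainv * delta (SR (sigma r)) + U * SR (sigma r) - SR r * U.
Proof.
move: r; apply: (conv_id_inj hopfR); try by lin.
move=> r; have := @comul_delta_sum r _ (fun u v => SR u * v).
rewrite [X in _ = _ + X](antipodel hopfR) counit_delta scale0r addr0.
have -> : \sum_(q <- DR r) SR (a * q.1) * delta q.2 =
    \sum_(q <- DR r) ainv * sigma (SR (sigma q.1)) * delta q.2.
  by apply: eq_bigr => q _; rewrite (antipodeM hopfR) Sa antipode_sigma.
have -> : \sum_(p <- w) \sum_(q <- DR r) SR (p.1 * q.1) * (p.2 * q.2) =
    \sum_(q <- DR r) SR q.1 * U * q.2.
  rewrite exchange_big; apply: eq_bigr => q _; rewrite mulr_sumr mulr_suml.
  by apply: eq_bigr => p _; rewrite (antipodeM hopfR) !mulrA.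
have -> : \sum_(q <- DR (sigma r)) \sum_(p <- w) SR (q.1 * p.1) * (q.2 * p.2) =
    \sum_(q <- DR r) U * SR (sigma q.1) * q.2.
  under [RHS]eq_bigr => q _ do rewrite -mulrA.
  rewrite -mulr_sumr -(@winding_comul_l r _ (fun u v => SR u * v)); last by lin.
  rewrite (antipodel hopfR) -scalerAr mulr1 exchange_big scaler_sumr.
  apply: eq_bigr => p _; rewrite scalerAl -[eR _ *: SR _]mulr1 -scalerAl scalerAr.
  rewrite -(antipodel hopfR) mulr_sumr mulr_suml.
  by apply: eq_bigr => q _; rewrite (antipodeM hopfR) !mulrA.
(* The derivation rule for [delta] applied to [sum S(sigma r_1) r_2], a scalar, which [delta]
   kills. *)
have d0 : \sum_(q <- DR r) ainv * delta (SR (sigma q.1)) * q.2 =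
    - \sum_(q <- DR r) ainv * sigma (SR (sigma q.1)) * delta q.2.
  apply/eqP; rewrite -addr_eq0 -big_split /=.
  under eq_bigr => q _ do rewrite -!mulrA -mulrDr -deltaM.
  rewrite -mulr_sumr -(linearFsum _ _ lind).
  rewrite -(@winding_comul_l r _ (fun u v => SR u * v)); last by lin.
  by rewrite (antipodel hopfR) (linearFZ _ _ lind) delta1 scaler0 mulr0.
move=> h; under [RHS]eq_bigr => q _ do rewrite mulrBl mulrDl.
rewrite sumrB big_split /= d0 -h; last by lin.
by rewrite [RHS](AC ((1*3)*1) (3*(1*2)*(4*5))) /= addNr subrr !addr0.
Qed.

(** * Structure maps on the skew polynomial algebra *)

Let d : ore_data R := OreData lins sigmaM sigma1 der.
Local Notation T := (ore d).
Local Notation i := (ore_const d).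
Local Notation x := (ore_var d).
Local Notation W := (\sum_(p <- w) p.1 * SR p.2).
Let lini := ore_const_linear d.
Let iM := ore_const_morphM d.
Let i1 := ore_const1 d.
Let xi r : x * i r = i (sigma r) * x + i (delta r).
Proof. exact: (proj1 (ore_skew d)). Qed.
(** Reduces linearity of the lifted maps to their behaviour on products and constants. *)
Let scaleE (l : F) (u : T) : l *: u = i (l *: 1) * u.
Proof. by rewrite (linearFZ _ _ lini) i1 -scalerAl mul1r. Qed.

Let varD : seq (T * T) := [:: (i a, x); (x, 1)] ++ tmap i w.
Let sum_varD (Z : zmodType) (f : T -> T -> Z) : \sum_(p <- varD) f p.1 p.2 =
  f (i a) x + f x 1 + \sum_(p <- w) f (i p.1) (i p.2).
Proof. by rewrite big_cat /= sum_tmap !big_cons big_nil addr0. Qed.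

Let phiD r : tensor T := tensor_of (tmap i (DR r)).

Let phiD_scale (l : F) : phiD (l *: 1) = tensor_of [:: (l *: 1, 1)].
Proof.
apply/tensorP => Z f hf; rewrite sum_tmap big_seq1 /=.
have hf' : bilinear_map (fun u v => f (i u) (i v)) by lin.
have := linDR l 1 0 hf'; rewrite addr0 => ->.
rewrite big_cat /= (sum_tscale _ _ hf') (teq2_D1 hopfR hf') big_seq1 /= i1.
have lg : linearF (fun u => \sum_(p <- DR u) f (i p.1) (i p.2)) by lin.
rewrite (linearF0 lg) addr0.
by rewrite (linearFZ (g := fun u => f u 1)) //; lin.
Qed.

Let phiD_add : {morph phiD : r s / r + s}.
Proof.
move=> r s; rewrite -tensor_ofD; apply/tensorP => Z f hf.
have lg : linearF (fun u => \sum_(p <- DR u) f (i p.1) (i p.2)) by lin.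
by rewrite big_cat /= !sum_tmap (linearFD lg).
Qed.

Let phiD_mul : {morph phiD : r s / r * s}.
Proof.
move=> r s; rewrite -tensor_ofM; apply/tensorP => Z f hf.
rewrite sum_tmul !sum_tmap (@sum_DM _ _ _ _ _ hopfR _ (fun u v => f (i u) (i v))); last by lin.
rewrite (sum_tmap i (fun u v => \sum_(q <- _) f (u * q.1) (v * q.2))).
apply: eq_bigr => p _; rewrite (sum_tmap i (fun u v => f (i p.1 * u) (i p.2 * v))).
by apply: eq_bigr => q _; rewrite !iM.
Qed.

Let phiD_one : phiD 1 = 1.
Proof.
rewrite -tensor_of1; apply/tensorP => Z f hf; rewrite sum_tmap.
rewrite (teq2_D1 hopfR (f := fun u v => f (i u) (i v))); last by lin.
by rewrite !big_seq1 /= i1.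
Qed.

(** The three parts of this relation are [winding_comul_r] for the terms in [1 (x) x],
    [winding_comul_l] for those in [x (x) 1], and (e) for those in [R (x) R]. *)
Let phiD_var r : tensor_of varD * phiD r =
  phiD (sigma r) * tensor_of varD + phiD (delta r).
Proof.
rewrite -!tensor_ofM -tensor_ofD; apply/tensorP => Z f hf.
have fDl y z u : f (y + z) u = f y u + f z u.
  by apply: (linearFD (g := fun v => f v u)); lin.
have fDr y z u : f u (y + z) = f u y + f u z by apply: (linearFD (g := f u)); lin.
rewrite (sum_tmul f varD) [RHS]big_cat /= (sum_tmul f _ varD) sum_tmap.
rewrite (sum_varD (fun u v => \sum_(q <- _) f (u * q.1) (v * q.2))).
rewrite (sum_tmap i (fun u v => f (i a * u) (x * v))).
rewrite (sum_tmap i (fun u v => f (x * u) (1 * v))).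
have -> : \sum_(p <- w) \sum_(q <- tmap i (DR r)) f (i p.1 * q.1) (i p.2 * q.2) =
    \sum_(p <- w) \sum_(q <- DR r) f (i (p.1 * q.1)) (i (p.2 * q.2)).
  apply: eq_bigr => p _; rewrite (sum_tmap i (fun u v => f (i p.1 * u) (i p.2 * v))).
  by apply: eq_bigr => q _; rewrite !iM.
rewrite (sum_tmap i (fun u v => \sum_(q <- _) f (u * q.1) (v * q.2))).
under [X in _ = X + _]eq_bigr => p _ do
  rewrite (sum_varD (fun u v => f (i p.1 * u) (i p.2 * v))) mulr1 -iM.
rewrite !big_split /=.
rewrite (@winding_comul_r r _ (fun u v => f (i u) (i v * x))); last by lin.
rewrite (@winding_comul_l r _ (fun u v => f (i u * x) (i v))); last by lin.
under eq_bigr => q _ do rewrite xi fDr -iM.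
under [X in _ + X + _ = _]eq_bigr => q _ do rewrite xi fDl mul1r.
rewrite !big_split /=.
have := @comul_delta_sum r _ (fun u v => f (i u) (i v)).
under [X in _ -> _ = _ + _ + X + _]eq_bigr => q _ do
  under eq_bigr => p _ do rewrite -!iM.
move=> h; rewrite -[RHS]addrA -h; last by lin.
by rewrite (AC ((2*2)*1) ((1*3)*(2*4*5))).
Qed.

Let Dl : T -> tensor T := ore_lift phiD (tensor_of varD).
Let DlD := ore_liftD (d := d) (tensor_of varD) phiD_add.
Let DlM := ore_liftM (d := d) phiD_add phiD_mul phiD_var.
Let Dl_const r : Dl (i r) = phiD r. Proof. exact: ore_lift_const. Qed.
Let Dl_var : Dl x = tensor_of varD. Proof. exact: ore_lift_var. Qed.

(** A comultiplication is valued in formal sums, so a representative of the class is chosen. *)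
Definition ore_comul (t : T) : seq (T * T) := tensor_repr (Dl t).
Local Notation DT := ore_comul.

Let DT_linear : linearT DT.
Proof.
move=> l u v; apply/tensorP; rewrite tensor_ofD tensor_of_scale !tensor_reprK.
by rewrite [Dl _]DlD; congr (_ + _); rewrite scaleE [LHS]DlM -/(Dl _) Dl_const phiD_scale.
Qed.

Let DT_mul u v : teq2 (DT (u * v)) (tmul (DT u) (DT v)).
Proof. by apply/tensorP; rewrite tensor_ofM !tensor_reprK [LHS]DlM. Qed.

Let DT_const r : teq2 (DT (i r)) (tmap i (DR r)).
Proof. by apply/tensorP; rewrite tensor_reprK Dl_const. Qed.

Let DT_var : teq2 (DT x) varD.
Proof. by apply/tensorP; rewrite tensor_reprK Dl_var. Qed.

Let sum_DTM (Z : lmodType F) (f : T -> T -> Z) u v : bilinear_map f ->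
  \sum_(p <- DT (u * v)) f p.1 p.2 =
  \sum_(p <- DT u) \sum_(q <- DT v) f (p.1 * q.1) (p.2 * q.2).
Proof. by move=> hf; rewrite (DT_mul u v hf) sum_tmul. Qed.

Let sum_DTc (Z : lmodType F) (f : T -> T -> Z) r : bilinear_map f ->
  \sum_(p <- DT (i r)) f p.1 p.2 = \sum_(p <- DR r) f (i p.1) (i p.2).
Proof. by move=> hf; rewrite (DT_const r hf) sum_tmap. Qed.

Let sum_DTx (Z : lmodType F) (f : T -> T -> Z) : bilinear_map f ->
  \sum_(p <- DT x) f p.1 p.2 =
  f (i a) x + f x 1 + \sum_(p <- w) f (i p.1) (i p.2).
Proof. by move=> hf; rewrite (DT_var hf) sum_varD. Qed.

Let counit_phiX r : 0 * eR r = eR (sigma r) * 0 + eR (delta r).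
Proof. by rewrite mul0r mulr0 counit_delta addr0. Qed.

Definition ore_counit : T -> F := ore_lift eR 0.
Local Notation eT := ore_counit.
Let eTD : {morph eT : u v / u + v} := ore_liftD (d := d) 0 (linformFD lineR).
Let eTM : {morph eT : u v / u * v} :=
  ore_liftM (d := d) (linformFD lineR) (counitM hopfR) counit_phiX.
Let eTc r : eT (i r) = eR r. Proof. exact: ore_lift_const (linformFD lineR) r. Qed.
Let eTx : eT x = 0.
Proof. exact: ore_lift_var 0 (linformFD lineR) (counit1 hopfR). Qed.
Let lineT : linformF eT.
Proof.
move=> l u v; rewrite eTD; congr (_ + _).
by rewrite scaleE eTM eTc (linformFZ _ _ lineR) (counit1 hopfR) mulr1.
Qed.

(* The antipode is an algebra map to the opposite algebra [T^c]. *)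
Let phiS (r : R) : T^c := i (SR r).
Let varS : T^c := - (i ainv * (x + i W)).
Let phiS_add : {morph phiS : r s / r + s}.
Proof. by move=> r s; rewrite /phiS (linearFD linSR) (linearFD lini). Qed.
Let phiS_mul : {morph phiS : r s / r * s}.
Proof. by move=> r s; rewrite /phiS (antipodeM hopfR) iM. Qed.
Let phiS_one : phiS 1 = 1.
Proof. by rewrite /phiS (antipode1 hopfR). Qed.

Let phiS_var r : varS * phiS r = phiS (sigma r) * varS + phiS (delta r).
Proof.
(* Products in [T^c] are reversed; this is the relation read in [T]. *)
suff: i (SR r) * - (i ainv * (x + i W)) =
   - (i ainv * (x + i W)) * i (SR (sigma r)) + i (SR (delta r)) :> T by [].
rewrite antipode_delta w_antipode !(linearFD lini) (linearFN _ lini).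
rewrite mulNr -!mulrA mulrDl xi -!iM mulrN !mulrDr !mulrA -!iM antipode_sigma.
rewrite !opprD !mulrA.
by rewrite [RHS](AC (3*3) (1*6*(2*4)*(3*5))) /= !addNr !addr0.
Qed.

Let Sl : T -> T^c := ore_lift phiS varS.
Definition ore_antipode (t : T) : T := Sl t.
Local Notation ST := ore_antipode.
Let STD : {morph ST : u v / u + v} := ore_liftD (d := d) varS phiS_add.
Let STM u v : ST (u * v) = ST v * ST u.
Proof. exact: (ore_liftM (d := d) phiS_add phiS_mul phiS_var). Qed.
Let STc r : ST (i r) = i (SR r). Proof. exact: ore_lift_const phiS_add r. Qed.
Let STx : ST x = - (i ainv * (x + i W)).
Proof. exact: ore_lift_var varS phiS_add phiS_one. Qed.
Let linST : linearF ST.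
Proof.
move=> l u v; rewrite STD; congr (_ + _).
rewrite scaleE STM STc (linearFZ _ _ linSR) (antipode1 hopfR) (linearFZ _ _ lini).
by rewrite i1 -scalerAr mulr1.
Qed.

(** * The Hopf axioms, verified on generators *)

Let ore_coassoc (t : T) (Z : lmodType F) (f : T -> T -> T -> Z) : trilinear_map f ->
  \sum_(p <- DT t) \sum_(q <- DT p.1) f q.1 q.2 p.2 =
  \sum_(p <- DT t) \sum_(q <- DT p.2) f p.1 q.1 q.2.
Proof.
(* The test map is generalized: the product case uses the induction hypotheses at other trilinear
   maps. *)
move=> hf; elim/ore_ind: t Z f hf => [r||u v Pu Pv|u v Pu Pv] Z f hf.
- rewrite (@sum_DTc _ (fun u v => \sum_(q <- DT u) f q.1 q.2 v)); last by lin.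
  rewrite (@sum_DTc _ (fun u v => \sum_(q <- DT v) f u q.1 q.2)); last by lin.
  under eq_bigr => p _ do
    rewrite (@sum_DTc _ (fun u v => f u v (i p.2)) p.1 ltac:(lin)).
  under [RHS]eq_bigr => p _ do
    rewrite (@sum_DTc _ (fun u v => f (i p.1) u v) p.2 ltac:(lin)).
  by apply: (@coassoc _ _ _ _ _ hopfR _ (fun u v y => f (i u) (i v) (i y))); lin.
- rewrite (@sum_DTx _ (fun u v => \sum_(q <- DT u) f q.1 q.2 v)); last by lin.
  rewrite (@sum_DTx _ (fun u v => \sum_(q <- DT v) f u q.1 q.2)); last by lin.
  rewrite (@sum_DTc _ (fun u v => f u v x)); last by lin.
  rewrite (Da (f := fun u v => f (i u) (i v) x)); last by lin.
  rewrite (@sum_DTx _ (fun u v => f u v 1)); last by lin.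
  rewrite (@sum_DTx _ (fun u v => f (i a) u v)); last by lin.
  rewrite -i1 (@sum_DTc _ (fun u v => f x u v)); last by lin.
  rewrite (teq2_D1 hopfR (f := fun u v => f x (i u) (i v))); last by lin.
  under [X in _ + X = _]eq_bigr => p _ do
    rewrite (@sum_DTc _ (fun u v => f u v (i p.2)) p.1 ltac:(lin)).
  under [X in _ = _ + X]eq_bigr => p _ do
    rewrite (@sum_DTc _ (fun u v => f (i p.1) u v) p.2 ltac:(lin)).
  (* At the variable, the terms containing [x] agree on both sides, and the rest is the cocycle
     condition on [w]. *)
  have := w_coassoc (f := fun u v y => f (i u) (i v) (i y)).
  rewrite !big_cat /= !big_map !big_allpairs_dep /= => h.
  rewrite !big_seq1 /= -!addrA h; last by lin.
  by rewrite !addrA (AC 5 (1*2*4*3*5)).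
- have l1 : linearF (fun t => \sum_(p <- DT t) \sum_(q <- DT p.1) f q.1 q.2 p.2) by lin.
  have l2 : linearF (fun t => \sum_(p <- DT t) \sum_(q <- DT p.2) f p.1 q.1 q.2) by lin.
  by rewrite (linearFD l1) (linearFD l2) Pu // Pv.
rewrite (@sum_DTM _ (fun u v => \sum_(q <- DT u) f q.1 q.2 v)); last by lin.
rewrite (@sum_DTM _ (fun u v => \sum_(q <- DT v) f u q.1 q.2)); last by lin.
(* Halfway point: coassociativity has been used for [u] but not yet for [v]. *)
transitivity (\sum_(p <- DT u) \sum_(q <- DT p.2) \sum_(p' <- DT v) \sum_(q' <- DT p'.1)
    f (p.1 * q'.1) (q.1 * q'.2) (q.2 * p'.2)).
  rewrite exchange_big /=; under [RHS]eq_bigr => p _ do rewrite exchange_big.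
  rewrite [RHS]exchange_big /=; apply: eq_bigr => p' _.
  rewrite -(Pu _ (fun y1 y2 y3 => \sum_(q' <- DT p'.1)
    f (y1 * q'.1) (y2 * q'.2) (y3 * p'.2))); last by lin.
  apply: eq_bigr => p _.
  by rewrite (@sum_DTM _ (fun u v => f u v (p.2 * p'.2))) //; lin.
apply: eq_bigr => p _.
under eq_bigr => q _ do
  rewrite (Pv _ (fun y1 y2 y3 => f (p.1 * y1) (q.1 * y2) (q.2 * y3)) ltac:(lin)).
rewrite exchange_big; apply: eq_bigr => p' _.
by rewrite (@sum_DTM _ (fun u v => f (p.1 * p'.1) u v)) //; lin.
Qed.

Let ore_counitl (t : T) : \sum_(p <- DT t) eT p.1 *: p.2 = t.
Proof.
elim/ore_ind: t => [r||u v Pu Pv|u v Pu Pv].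
- rewrite (@sum_DTc _ (fun u v => eT u *: v)); last by lin.
  under eq_bigr => p _ do rewrite eTc.
  by rewrite (counitl_lin hopfR _ lini).
- rewrite (@sum_DTx _ (fun u v => eT u *: v)); last by lin.
  rewrite eTc ea eTx scale0r scale1r addr0.
  rewrite (w_zero (f := fun u v => eT (i u) *: i v)) ?addr0 //; first by lin.
  by move=> u v eu _; rewrite eTc eu scale0r.
- have l1 : linearF (fun t => \sum_(p <- DT t) eT p.1 *: p.2) by lin.
  by rewrite (linearFD l1) Pu Pv.
rewrite (@sum_DTM _ (fun u v => eT u *: v)); last by lin.
rewrite -[in RHS]Pu mulr_suml; apply: eq_bigr => p _.
rewrite -[in RHS]Pv mulr_sumr; apply: eq_bigr => q _.
by rewrite eTM -scalerAr -scalerAl scalerA mulrC.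
Qed.

Let ore_counitr (t : T) : \sum_(p <- DT t) eT p.2 *: p.1 = t.
Proof.
elim/ore_ind: t => [r||u v Pu Pv|u v Pu Pv].
- rewrite (@sum_DTc _ (fun u v => eT v *: u)); last by lin.
  under eq_bigr => p _ do rewrite eTc.
  by rewrite (counitr_lin hopfR _ lini).
- rewrite (@sum_DTx _ (fun u v => eT v *: u)); last by lin.
  rewrite -i1 eTc (counit1 hopfR) eTx scale0r scale1r add0r.
  rewrite (w_zero (f := fun u v => eT (i v) *: i u)) ?addr0 //; first by lin.
  by move=> u v _ ev; rewrite eTc ev scale0r.
- have l1 : linearF (fun t => \sum_(p <- DT t) eT p.2 *: p.1) by lin.
  by rewrite (linearFD l1) Pu Pv.
rewrite (@sum_DTM _ (fun u v => eT v *: u)); last by lin.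
rewrite -[in RHS]Pu mulr_suml; apply: eq_bigr => p _.
rewrite -[in RHS]Pv mulr_sumr; apply: eq_bigr => q _.
by rewrite eTM -scalerAr -scalerAl scalerA mulrC.
Qed.

Let ore_antipodel (t : T) : \sum_(p <- DT t) ST p.1 * p.2 = eT t *: 1.
Proof.
elim/ore_ind: t => [r||u v Pu Pv|u v Pu Pv].
- rewrite (@sum_DTc _ (fun u v => ST u * v)); last by lin.
  under eq_bigr => p _ do rewrite STc -iM.
  by rewrite -(linearFsum _ _ lini) (antipodel hopfR) (linearFZ _ _ lini) eTc.
- rewrite (@sum_DTx _ (fun u v => ST u * v)); last by lin.
  under eq_bigr => p _ do rewrite STc -iM.
  rewrite -(linearFsum _ _ lini) w_antipode STc Sa STx eTx scale0r mulr1 mulrDr iM.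
  by rewrite opprD addrA addrN add0r addNr.
- have l1 : linearF (fun t => \sum_(p <- DT t) ST p.1 * p.2) by lin.
  by rewrite (linearFD l1) Pu Pv eTD scalerDl.
rewrite (@sum_DTM _ (fun u v => ST u * v)); last by lin.
rewrite exchange_big.
transitivity (\sum_(q <- DT v) ST q.1 * (\sum_(p <- DT u) ST p.1 * p.2) * q.2).
  apply: eq_bigr => q _; rewrite mulr_sumr mulr_suml.
  by apply: eq_bigr => p _; rewrite STM !mulrA.
under eq_bigr => q _ do rewrite Pu -scalerAr mulr1 -scalerAl.
by rewrite -scaler_sumr Pv eTM scalerA.
Qed.

Let ore_antipoder (t : T) : \sum_(p <- DT t) p.1 * ST p.2 = eT t *: 1.
Proof.
elim/ore_ind: t => [r||u v Pu Pv|u v Pu Pv].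
- rewrite (@sum_DTc _ (fun u v => u * ST v)); last by lin.
  under eq_bigr => p _ do rewrite STc -iM.
  by rewrite -(linearFsum _ _ lini) (antipoder hopfR) (linearFZ _ _ lini) eTc.
- rewrite (@sum_DTx _ (fun u v => u * ST v)); last by lin.
  under eq_bigr => p _ do rewrite STc -iM.
  rewrite -(linearFsum _ _ lini) STx eTx scale0r -[in ST 1]i1 STc (antipode1 hopfR).
  by rewrite i1 mulr1 mulrN mulrA -iM aK i1 mul1r -addrA addNr.
- have l1 : linearF (fun t => \sum_(p <- DT t) p.1 * ST p.2) by lin.
  by rewrite (linearFD l1) Pu Pv eTD scalerDl.
rewrite (@sum_DTM _ (fun u v => u * ST v)) /=; last by lin.
transitivity (\sum_(p <- DT u) p.1 * (\sum_(q <- DT v) q.1 * ST q.2) * ST p.2).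
  apply: eq_bigr => p _; rewrite mulr_sumr mulr_suml.
  by apply: eq_bigr => q _; rewrite STM !mulrA.
under eq_bigr => p _ do rewrite Pv -scalerAr mulr1 -scalerAl.
by rewrite -scaler_sumr Pu eTM scalerA mulrC.
Qed.

Let ST_surj (t : T) : exists u, ST u = t.
Proof.
have [S' _ S'K] := antipode_bij hopfR.
elim/ore_ind: t => [r||u v [u' <-] [v' <-]|u v [u' <-] [v' <-]].
- by exists (i (S' r)); rewrite STc S'K.
(* From [a S(x) = - (x + W)] one gets [x = - a S(x) - W]; the witness is the preimage of the right
   side, with factors reversed. *)
- exists (- (x * i (S' a)) - i (S' W)).
  rewrite STD !(linearFN _ linST) STM !STc !S'K STx mulrN opprK mulrA -iM aK.
  by rewrite i1 mul1r addrK.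
- by exists (u' + v'); rewrite STD.
by exists (v' * u'); rewrite STM.
Qed.

(* [S x] is again a skew variable over [R], so its powers are also a basis of
   [T] as a right module. *)
Let ST_inj : injective ST.
Proof.
have [S' SK _] := antipode_bij hopfR.
have kerS u : ST u = 0 -> u = 0.
  (* With [y = S(x)], the antipode sends [sum u_k x^k] to [sum y^k S(u_k)], whose vanishing forces
     every [S(u_k)] to be zero. *)
  rewrite {1}(ore_expand u) (linearFsum _ _ linST).
  have STxE : ST x = i (- ainv) * x + i (- (ainv * W)).
    by rewrite STx mulrDr opprD !(linearFN _ lini) iM mulNr.
  pose y := i (- ainv) * x + i (- (ainv * W)).
  have NaK : - ainv * - a = 1 by rewrite mulrNN.
  have NKa : - a * - ainv = 1 by rewrite mulrNN.
  have sk := change_var_skew lini iM i1 lins sigmaM sigma1 der (ore_skew d)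
    (- (ainv * W)) NaK NKa.
  have auto' := change_var_auto lins sigmaM sigma1 NaK NKa sigma_bij.
  have der' := change_var_der lins sigmaM der (- (ainv * W)) NKa.
  have STX n : ST (x ^+ n) = y ^+ n.
    elim: n => [|n IH]; first by rewrite !expr0 -i1 STc (antipode1 hopfR).
    by rewrite exprS STM IH STxE exprSr.
  under eq_bigr => k _ do rewrite STM STc STX.
  case: auto' => [la [aM [a1 ab]]].
  move=> /(skew_free_right lini la der' sk (bij_inj ab)
    (g := fun k => SR (u : {poly R})`_k)) u0.
  rewrite (ore_expand u) big1 // => k _.
  have /(congr1 S') := u0 k (ltn_ord k); rewrite SK => ->.
  have -> : S' 0 = 0 by rewrite -{1}(linearF0 linSR) SK.
  by rewrite (linearF0 lini) mul0r.
move=> u v uv; apply/eqP; rewrite -subr_eq0; apply/eqP/kerS.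
by rewrite STD (linearFN _ linST) uv subrr.
Qed.

Let ST_bij : bijective ST.
Proof.
exists (fun t => projT1 (cid (ST_surj t))) => t; last by case: cid.
by case: cid => u /= /ST_inj.
Qed.

Lemma ore_is_hopf : is_hopf DT eT ST.
Proof.
split; first exact: DT_linear.
split; first exact: DT_mul.
split; first by have := DT_const 1; move=> h Z f hf; rewrite -{1}i1 h // sum_tmap
  (teq2_D1 hopfR (f := fun u v => f (i u) (i v))) ?big_seq1 ?i1 //; lin.
split.
  by move=> t Z f hf; rewrite !big_allpairs_dep /=; apply: ore_coassoc.
split; first exact: lineT.
split; first exact: eTM.
split; first by rewrite -i1 eTc (counit1 hopfR).
split; first exact: ore_counitl.
split; first exact: ore_counitr.
split; first exact: linST.
split; first exact: ore_antipodel.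
split; first exact: ore_antipoder.
exact: ST_bij.
Qed.

Lemma ore_HOE : HOE DR eR SR DT eT ST i x sigma delta a 1 [::] w.
Proof.
split; first exact: hopfR.
split; first exact: ore_is_hopf.
split.
  split; first exact: ore_const_inj.
  split; first exact: lini.
  split; first exact: iM.
  by split.
split; first exact: autos.
split; first exact: der.
split; first exact: ore_skew.
by rewrite i1; apply: DT_var.
Qed.

Lemma ore_counit_var : eT x = 0. Proof. exact: eTx. Qed.

Lemma ore_antipode_var : ST x = - (i ainv * (x + i W)).
Proof. exact: STx. Qed.

End Converse.

Theorem theorem2p4 (F : fieldType) (R : algType F)
    (DR : R -> seq (R * R)) (eR : R -> F) (SR : R -> R) :
  is_hopf DR eR SR ->
  (* (i)(a),(b) *)
  (forall (T : algType F) (DT : T -> seq (T * T)) (eT : T -> F) (ST : T -> T)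
      (i : R -> T) (x : T) (sigma delta : R -> R) (a b : R) (v w : seq (R * R)),
    HOE DR eR SR DT eT ST i x sigma delta a b v w ->
    (exists alpha beta : R,
        (exists alpha' : R, alpha * alpha' = 1 /\ alpha' * alpha = 1) /\
        ST x = i alpha * x + i beta) ->
    (grouplike DR a /\ grouplike DR b /\ teq2 v [::]) /\
    (exists (c c' d : R) (sigma' delta' : R -> R) (a' : R) (w' : seq (R * R)),
        c * c' = 1 /\ c' * c = 1 /\
        let x' := i c * x + i d in
        skew_poly i x' sigma' delta' /\ alg_auto sigma' /\ sigma_der sigma' delta' /\
        eT x' = 0 /\ teq2 (DT x') ([:: (i a', x'); (x', 1)] ++ tmap i w'))) /\
  (* (i)(c)-(f), under the normalization eps(x) = 0, Δ(x) = a⊗x + x⊗1 + w *)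
  (forall (T : algType F) (DT : T -> seq (T * T)) (eT : T -> F) (ST : T -> T)
      (i : R -> T) (x : T) (sigma delta : R -> R) (a : R) (w : seq (R * R)),
    HOE DR eR SR DT eT ST i x sigma delta a 1 [::] w ->
    eT x = 0 ->
    (exists alpha beta : R,
        (exists alpha' : R, alpha * alpha' = 1 /\ alpha' * alpha = 1) /\
        ST x = i alpha * x + i beta) ->
    exists ainv : R, a * ainv = 1 /\ ainv * a = 1 /\
      ST x = - (i ainv * (x + i (\sum_(p <- w) p.1 * SR p.2))) /\
      conds_def DR eR SR a ainv w sigma delta) /\
  (* (ii) converse *)
  (forall (a ainv : R) (w : seq (R * R)) (sigma delta : R -> R),
    grouplike DR a -> a * ainv = 1 -> ainv * a = 1 ->
    alg_auto sigma -> sigma_der sigma delta ->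
    conds_def DR eR SR a ainv w sigma delta ->
    exists (T : algType F) (DT : T -> seq (T * T)) (eT : T -> F) (ST : T -> T)
           (i : R -> T) (x : T),
      HOE DR eR SR DT eT ST i x sigma delta a 1 [::] w /\ eT x = 0 /\
      ST x = - (i ainv * (x + i (\sum_(p <- w) p.1 * SR p.2)))).
Proof.
move=> hopfR; split; last split.
- move=> T DT eT ST i x sigma delta a b v w hoe.
  move=> [alpha [beta [[alpha' [_ alphaK]] STx]]].
  split; last exact: (normalized_variable hoe alphaK STx).
  split; first exact: (grouplike_a hoe alphaK STx).
  by split; [exact: (grouplike_b hoe alphaK STx) | exact: (v_eq0 hoe alphaK STx)].
- move=> T DT eT ST i x sigma delta a w hoe eTx.
  move=> [alpha [beta [[alpha' [_ alphaK]] STx]]].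
  exists (SR a); split; first exact: (inv_a hoe alphaK STx).
  split; first exact: (antipode_a_inv hoe alphaK STx).
  split; first exact: (antipode_var hoe alphaK STx).
  exact: (conditions_hold hoe alphaK STx).
move=> a ainv w sigma delta gla aK Ka autos der.
move=> [[chi [[chiL [chiM chi1]] chiE]] [wD [wA [wS wC]]]].
have sl r := proj1 (chiE r); have sr r := proj2 (chiE r).
(* The algebra, its structure maps and the variable are filled in by unification with [ore_HOE]. *)
do 6!eexists; split.
  exact: (ore_HOE hopfR gla aK Ka autos der chiL chiM chi1 sl sr wD wA wS wC).
by split; [exact: (ore_counit_var hopfR) | exact: (ore_antipode_var hopfR)].
Qed.
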